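(* Let $f:=\frac{\eta^6(z)\eta^6(4z)}{\eta^3(2z)}\in S_{9/2}(\Gamma_1(4))$ and let $f^{-1}=\sum_n a(n)q^n$. For a prime $\ell$ and $b\in\mathbb{Z}$, one has $a(\ell n+b)\equiv 0\pmod{\ell}$ for all $n\in\mathbb{Z}$ if and only if one of the following holds: $\ell=2$ and $b\equiv 0\pmod 2$; $\ell=3$ and $b\equiv 0$ or $1\pmod 3$; $\ell=5$ and $b\equiv 2$ or $3\pmod 5$.
   Context: $q=e^{2\pi i z}$ and $\eta(z)=q^{1/24}\prod_{n=1}^\infty(1-q^n)$. Since $f=q+\cdots$ has integer coefficients, $f^{-1}=q^{-1}+\cdots$ is a Laurent series with integer coefficients; $a(n)=0$ for $n<-1$. *)

(* Defs.v *)
From mathcomp Require Import all_boot all_order all_algebra.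
From mathcomp Require Import complex.
From mathcomp Require Import all_classical all_reals all_analysis.

Set Implicit Arguments.
Unset Strict Implicit.
Unset Printing Implicit Defensive.

Import Order.TTheory GRing.Theory Num.Theory.
Import numFieldNormedType.Exports.

Local Open Scope classical_set_scope.
Local Open Scope ring_scope.
Local Open Scope complex_scope.

(* exp (x + iy) = exp x * (cos y + i sin y) *)
Definition cexp (R : realType) (z : R[i]) : R[i] :=
  (expR (complex.Re z))%:C * (cos (complex.Im z) +i* sin (complex.Im z)).

(* e(z) = exp (2 pi i z) *)
Definition e2pii (R : realType) (z : R[i]) : R[i] :=
  cexp ((0 +i* (2 * pi)) * z).

(* R[i]^o is R[i] with the topology of its norm. The factor q^(1/24) is
   e(z / 24). The infinite product converges to a nonzero limit for z in the
   upper half-plane, the only place where eta is used. *)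
Definition eta (R : realType) (z : R[i]) : R[i] :=
  e2pii (z / 24) *
  lim ((\prod_(1 <= n < N.+1) (1 - e2pii z ^+ n) : R[i]^o) @[N --> \oo]).

Definition eta_quotient (R : realType) (z : R[i]) : R[i] :=
  eta z ^+ 6 * eta (4 * z) ^+ 6 / eta (2 * z) ^+ 3.

(* g(z) = \sum_(n >= - m) a(n) q^n, q = e(z), on the upper half-plane. The
   index k stands for n + m. *)
Definition has_qexpansion (R : realType) (g : R[i] -> R[i]) (m : nat)
    (a : int -> int) : Prop :=
  (forall n : int, n < - m%:Z -> a n = 0) /\
  (forall z : R[i], 0 < complex.Im z ->
     (\sum_(0 <= k < N)
         (a (k%:Z - m%:Z))%:~R * e2pii z ^ (k%:Z - m%:Z) : R[i]^o)
       @[N --> \oo] --> (g z : R[i]^o)).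

(* Main.v *)
From HB Require Import structures.
Require Import Defs.
From mathcomp Require Import all_boot all_order all_algebra.
From mathcomp Require Import closed_field complex.
From mathcomp Require Import ring zify lra.
From mathcomp Require Import all_classical all_reals all_analysis.
Import Order.TTheory GRing.Theory Num.Theory.
Import numFieldNormedType.Exports.
Local Open Scope ring_scope.
Set Implicit Arguments.
Unset Strict Implicit.
Unset Printing Implicit Defensive.

(** Write phi = sum_n q^(n^2), phim = phi(-q), E = prod_n (1 - q^n),
    D = q d/dq, and V for the substitution q -> q^2.  Along the imaginary axis
    the expansion of 1/f is asymptotic as q -> 0+, which forces the identity
    (sum_k a(k - 1) q^k) phim^3 E(q^4)^6 = 1 of formal power series.

    Put t = 1 - (phim / phi)^4.  The relations phi^2 + phim^2 = 2 V(phi)^2 and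
    phi phim = V(phim)^2 of the arithmetic-geometric mean imply that certain
    power series v satisfy V(v) = v and are therefore constant.  This gives
    16 f = phi^9 t (1 - t), D t = t (1 - t) phi^4 and, modulo a prime
    l = 2m + 1, phi^(4m) H(t) = 1 where H is the Hasse polynomial of the
    Legendre family.  By its hypergeometric equation H has simple roots, all
    different from 0 and 1.

    Modulo l, the class b + l Z is a class of vanishing for 1/f if and only if
    it is one for g = (16 f)^(l-1), since f^l is a series in q^l.  For b <> 0
    it is then one for which sum_(1 <= i < l) b^(l-1-i) D^i g = 0.  Now
    D^i g = phi^(18m+4i) Q_i(t) / H(t)^i, and Q_i(a) <> 0 at a root a of H as
    long as 9m + j <> 0 modulo l for all j < i.  As z = phi^(-4) satisfies
    z^m = H(t), which is Eisenstein at a, the powers 1, z, ..., z^(m-1) are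
    linearly independent over polynomials in t.  The terms i = 1 and i = m + 1
    of the sum, the only ones with their power of z, hence cancel, and
    Q_(m+1)(a) = 0, which is impossible for l >= 11.  The class b = 0 and the
    remaining classes for l <= 7 are excluded by the first coefficients
    1, 6, 24, 80, 240, 660, 1696.  Conversely D (f/q) = 0 modulo 2 and 3, and
    D^3 g = D g modulo 5. *)

(** * Formal power series *)

Record fps (R : Type) := Fps { coef : nat -> R }.

Lemma fpsP (R : Type) (x y : fps R) : coef x =1 coef y <-> x = y.
Proof.
split=> [|-> //]; case: x y => f [g] /= fg.
by congr Fps; apply/funext.
Qed.

HB.instance Definition _ (R : Type) := gen_eqMixin (fps R).
HB.instance Definition _ (R : Type) := gen_choiceMixin (fps R).

Section FpsRing.
Variable R : comNzRingType.
Implicit Types x y z : fps R.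

Definition fps_add x y := Fps (fun n => coef x n + coef y n).
Definition fps_opp x := Fps (fun n => - coef x n).
Definition fps_zero : fps R := Fps (fun=> 0).

Fact fps_addA : associative fps_add.
Proof. by move=> x y z; apply/fpsP => n /=; rewrite addrA. Qed.
Fact fps_addC : commutative fps_add.
Proof. by move=> x y; apply/fpsP => n /=; rewrite addrC. Qed.
Fact fps_add0 : left_id fps_zero fps_add.
Proof. by move=> x; apply/fpsP => n /=; rewrite add0r. Qed.
Fact fps_addN : left_inverse fps_zero fps_opp fps_add.
Proof. by move=> x; apply/fpsP => n /=; rewrite addNr. Qed.

HB.instance Definition _ :=
  GRing.isZmodule.Build (fps R) fps_addA fps_addC fps_add0 fps_addN.

Definition trunc N x := \poly_(i < N.+1) coef x i.

Lemma coef_trunc N x n : (n <= N)%N -> (trunc N x)`_n = coef x n.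
Proof. by move=> nN; rewrite coef_poly ltnS nN. Qed.

(** Reading the product off polynomial truncations lets the ring axioms be inherited from
    [{poly R}]. *)
Definition fps_mul x y := Fps (fun n => (trunc n x * trunc n y)`_n).
Definition fps_one : fps R := Fps (fun n => (n == 0%N)%:R).

Lemma coefM_congr (p p' r r' : {poly R}) n :
    (forall i, (i <= n)%N -> p`_i = p'`_i) ->
    (forall i, (i <= n)%N -> r`_i = r'`_i) ->
  (p * r)`_n = (p' * r')`_n.
Proof.
move=> pp' rr'; rewrite !coefM; apply: eq_bigr => i _.
by rewrite pp' ?rr' ?leq_subr // -ltnS.
Qed.

Lemma coef_fps_mul N x y n :
  (n <= N)%N -> coef (fps_mul x y) n = (trunc N x * trunc N y)`_n.
Proof.
move=> nN /=; apply: coefM_congr => i ni;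
by rewrite !coef_trunc // (leq_trans ni).
Qed.

Fact fps_mulA : associative fps_mul.
Proof.
move=> x y z; apply/fpsP => n; rewrite !(@coef_fps_mul n) //.
rewrite (@coefM_congr _ (trunc n x) _ (trunc n y * trunc n z)) //; last first.
  by move=> i ni; rewrite coef_trunc // (coef_fps_mul _ _ ni).
rewrite mulrA; apply: coefM_congr => // i ni.
by rewrite coef_trunc // (coef_fps_mul _ _ ni).
Qed.

Fact fps_mulC : commutative fps_mul.
Proof. by move=> x y; apply/fpsP => n /=; rewrite mulrC. Qed.

Lemma trunc_one N : trunc N fps_one = 1.
Proof.
apply/polyP => i; rewrite coef_poly coef1.
by case: ifP => //=; case: i.
Qed.

Fact fps_mul1 : left_id fps_one fps_mul.
Proof. by move=> x; apply/fpsP => n /=; rewrite trunc_one mul1r coef_trunc. Qed.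

Fact fps_mulDl : left_distributive fps_mul fps_add.
Proof.
move=> x y z; apply/fpsP => n /=; rewrite -coefD -mulrDl.
by apply: coefM_congr => // i ni; rewrite coefD !coef_trunc.
Qed.

Fact fps_one_neq0 : fps_one != fps_zero.
Proof.
apply/eqP => /fpsP /(_ 0%N) /= /eqP.
by rewrite oner_eq0.
Qed.

HB.instance Definition _ := GRing.Zmodule_isComNzRing.Build (fps R)
  fps_mulA fps_mulC fps_mul1 fps_mulDl fps_one_neq0.

Lemma coef_fps0 n : coef (0 : fps R) n = 0. Proof. by []. Qed.
Lemma coef_fps1 n : coef (1 : fps R) n = (n == 0%N)%:R. Proof. by []. Qed.
Lemma coef_fpsD x y n : coef (x + y) n = coef x n + coef y n. Proof. by []. Qed.
Lemma coef_fpsN x n : coef (- x) n = - coef x n. Proof. by []. Qed.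
Lemma coef_fpsB x y n : coef (x - y) n = coef x n - coef y n. Proof. by []. Qed.

Lemma coef_fpsMtrunc N x y n :
  (n <= N)%N -> coef (x * y) n = (trunc N x * trunc N y)`_n.
Proof. exact: coef_fps_mul. Qed.

Lemma coef_fpsM x y n :
  coef (x * y) n = \sum_(i < n.+1) coef x i * coef y (n - i).
Proof.
rewrite (@coef_fpsMtrunc n) // coefM; apply: eq_bigr => i _.
by rewrite !coef_trunc ?leq_subr // -ltnS.
Qed.

Lemma coef_fps_sum I (r : seq I) (P : pred I) (F : I -> fps R) n :
  coef (\sum_(i <- r | P i) F i) n = \sum_(i <- r | P i) coef (F i) n.
Proof.
by elim/big_rec2: _ => [|i x y _ <-].
Qed.

Lemma coef_fpsMn x k n : coef (x *+ k) n = coef x n *+ k.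
Proof. by elim: k => // k IH; rewrite !mulrS coef_fpsD IH. Qed.

Definition fpsX : fps R := Fps (fun n => (n == 1%N)%:R).

Lemma coef_fpsXM x n : coef (fpsX * x) n = if n is n'.+1 then coef x n' else 0.
Proof.
rewrite coef_fpsM; case: n => [|n].
  by rewrite big_ord1 /= mul0r.
rewrite big_ord_recl big_ord_recl /= mul0r mul1r add0r big1 ?addr0 //.
  by rewrite /bump /= subSS subn0.
by move=> i _; rewrite /= mul0r.
Qed.

Lemma coef_fpsXnM x k n :
  coef (fpsX ^+ k * x) n = if (n < k)%N then 0 else coef x (n - k).
Proof.
elim: k n => [|k IH] n; first by rewrite expr0 mul1r subn0.
by rewrite exprS -mulrA coef_fpsXM; case: n => // n; rewrite IH ltnS subSS.
Qed.

Lemma coef_fpsXn k n : coef (fpsX ^+ k) n = (n == k)%:R.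
Proof.
rewrite -[_ ^+ _]mulr1 coef_fpsXnM coef_fps1 subn_eq0 eqn_leq.
by case: ltnP; rewrite ?andbF ?andbT.
Qed.

Definition fpsC (c : R) : fps R := Fps (fun n => if n is 0 then c else 0).

Lemma coef_fpsCM c x n : coef (fpsC c * x) n = c * coef x n.
Proof.
rewrite coef_fpsM big_ord_recl /= subn0 big1 ?addr0 //.
by move=> i _; rewrite mul0r.
Qed.

Fact fpsC_zmod : zmod_morphism fpsC.
Proof. by move=> c d; apply/fpsP => -[|n] //=; rewrite oppr0 addr0. Qed.
Fact fpsC_monoid : monoid_morphism fpsC.
Proof.
split; first by apply/fpsP => -[].
move=> c d; apply/fpsP => n; rewrite coef_fpsCM /=.
by case: n => //=; rewrite mulr0.
Qed.
HB.instance Definition _ :=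
  GRing.isZmodMorphism.Build R (fps R) fpsC fpsC_zmod.
HB.instance Definition _ :=
  GRing.isMonoidMorphism.Build R (fps R) fpsC fpsC_monoid.

(** Invertibility is the bare existence of an inverse, picked by choice, which works over any [R];
    over a field [fps_unit_coef0] gives the criterion on the constant term. *)
Definition fps_unit : pred (fps R) := fun x => `[< exists y, y * x = 1 >].
Definition fps_inv x :=
  if pselect (exists y, y * x = 1) is left e then projT1 (cid e) else x.

Fact fps_mulVr : {in fps_unit, left_inverse 1 fps_inv *%R}.
Proof.
move=> x /asboolP e; rewrite /fps_inv; case: pselect => // e'.
by case: cid.
Qed.
Fact fps_unitP x y : y * x = 1 -> fps_unit x.
Proof. by move=> e; apply/asboolP; exists y. Qed.
Fact fps_inv_out : {in [predC fps_unit], fps_inv =1 id}.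
Proof.
move=> x; rewrite inE => /asboolP e; rewrite /fps_inv.
by case: pselect.
Qed.
HB.instance Definition _ := GRing.ComNzRing_hasMulInverse.Build (fps R)
  fps_mulVr fps_unitP fps_inv_out.

Definition fps_eqmod N x y := forall n, (n < N)%N -> coef x n = coef y n.

Lemma fps_eqmodM N x y x' y' :
  fps_eqmod N x y -> fps_eqmod N x' y' -> fps_eqmod N (x * x') (y * y').
Proof.
move=> h h' n nN; rewrite !coef_fpsM; apply: eq_bigr => i _.
by rewrite h ?h' //; have := ltn_ord i; lia.
Qed.

Lemma fps_eqmodX N x y k : fps_eqmod N x y -> fps_eqmod N (x ^+ k) (y ^+ k).
Proof.
by move=> h; elim: k => // k IH; rewrite !exprS; apply: fps_eqmodM.
Qed.

Lemma fps_eqmodP N x y : fps_eqmod N x y <-> exists z, x = y + fpsX ^+ N * z.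
Proof.
split=> [h|[z -> n nN]]; last first.
  by rewrite coef_fpsD coef_fpsXnM nN addr0.
exists (Fps (fun n => coef (x - y) (n + N))); apply/fpsP => n.
rewrite coef_fpsD coef_fpsXnM; case: ltnP => [/h ->|Nn]; first by rewrite addr0.
by rewrite /= subnK // addrC subrK.
Qed.

End FpsRing.
Arguments fpsX {R}.

Section FpsDomain.
Variable R : idomainType.

(** If [i] and [j] are the lowest exponents of the two factors, a single term contributes to the
    coefficient of the product at [i + j]. *)
Fact fps_idomain : GRing.integral_domain_axiom (fps R).
Proof.
move=> x y xy0; apply/orP.
case: (pselect (exists n, coef x n != 0)) => [ex|nx]; last first.
  left; apply/eqP/fpsP => n; apply/eqP/negP => /negP xn; apply: nx.
  by exists n.
case: (pselect (exists n, coef y n != 0)) => [ey|ny]; last first.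
  right; apply/eqP/fpsP => n; apply/eqP/negP => /negP yn; apply: ny.
  by exists n.
case: (ex_minnP ex) => i xi mi; case: (ex_minnP ey) => j yj mj.
have /fpsP/(_ (i + j)%N) := xy0; rewrite coef_fpsM coef_fps0.
have hi : (i < (i + j).+1)%N by rewrite ltnS leq_addr.
rewrite (bigD1 (Ordinal hi)) //= big1 => [|k /eqP ki].
  by rewrite addr0 addKn => /eqP; rewrite mulf_eq0 (negbTE xi) (negbTE yj).
have [lti|] := ltnP k i.
  have -> : coef x k = 0; last by rewrite mul0r.
  by apply/eqP/negP => /negP /mi; rewrite leqNgt lti.
move=> ik; have -> : coef y (i + j - k) = 0; last by rewrite mulr0.
apply/eqP/negP => /negP /mj.
have : i <> k by move=> e; apply: ki; apply: val_inj.
by have := ltn_ord k; lia.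
Qed.
HB.instance Definition _ :=
  GRing.ComUnitRing_isIntegral.Build (fps R) fps_idomain.
End FpsDomain.

(** * The derivation D and the substitution V *)

Section FpsMaps.
Variable R : comNzRingType.
Implicit Types x y : fps R.

Definition fpsD x : fps R := Fps (fun n => coef x n *+ n).

Lemma coef_D x n : coef (fpsD x) n = coef x n *+ n. Proof. by []. Qed.

Lemma fpsD_add x y : fpsD (x + y) = fpsD x + fpsD y.
Proof. by apply/fpsP => n /=; rewrite mulrnDl. Qed.

Lemma fpsD_mul x y : fpsD (x * y) = fpsD x * y + x * fpsD y.
Proof.
apply/fpsP => n; rewrite coef_fpsD coef_D !coef_fpsM -big_split -sumrMnl.
apply: eq_bigr => i _; rewrite !coef_D.
by rewrite /= mulrnAl mulrnAr -[RHS]mulrnDr subnKC // -ltnS.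
Qed.

Lemma fpsD_const c : fpsD (fpsC c) = 0.
Proof. by apply/fpsP => -[|n] //=; rewrite mul0rn. Qed.

Lemma fpsD_nat k : fpsD (k%:R) = 0.
Proof. by rewrite -(rmorph_nat (@fpsC R)) fpsD_const. Qed.

Lemma fpsD_exp x k : fpsD (x ^+ k) = k%:R * x ^+ k.-1 * fpsD x.
Proof.
elim: k => [|k IH]; first by rewrite expr0 -[1]/(1%:R) fpsD_nat !mul0r.
rewrite exprS fpsD_mul IH /=; case: k {IH} => [|k] /=.
  by rewrite expr0; ring.
by rewrite -[k.+2%:R]natr1 exprS; ring.
Qed.

Lemma coef_fpsD_iter x k n : coef (iter k fpsD x) n = n%:R ^+ k * coef x n.
Proof.
elim: k => [|k IH]; first by rewrite expr0 mul1r.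
by rewrite iterS /= IH exprS -mulrA mulr_natl.
Qed.

Definition fpsV x : fps R := Fps (fun n => if odd n then 0 else coef x n./2).

Lemma coef_V x n : coef (fpsV x) n = if odd n then 0 else coef x n./2.
Proof. by []. Qed.

Fact fpsV_zmod : zmod_morphism fpsV.
Proof. by move=> x y; apply/fpsP => n /=; case: odd => //; rewrite subr0. Qed.

Lemma sum_evens (F : nat -> R) n : (forall i, odd i -> F i = 0) ->
  \sum_(i < n.*2.+1) F i = \sum_(i < n.+1) F i.*2.
Proof.
move=> F0; elim: n => [|n IH]; first by rewrite !big_ord1.
rewrite doubleS 2!big_ord_recr [RHS]big_ord_recr -IH /= (F0 n.*2.+1).
  by rewrite addr0.
by rewrite /= odd_double.
Qed.

Fact fpsV_monoid : monoid_morphism fpsV.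
Proof.
split; first by apply/fpsP => n /=; case: n => [|[|n]] //=; case: odd.
move=> x y; apply/fpsP => n; rewrite coef_fpsM coef_V.
under eq_bigr => i _ do rewrite !coef_V.
case: ifP => [on|on].
  rewrite big1 // => i _; case: ifP => oi; first by rewrite mul0r.
  by rewrite oddB ?on ?oi ?mulr0 // -ltnS.
have -> : n = (n./2).*2 by rewrite -[LHS]odd_double_half on.
rewrite doubleK; set k := n./2.
rewrite (sum_evens (F := fun i => (if odd i then 0 else coef x i./2) *
   (if odd (k.*2 - i) then 0 else coef y (k.*2 - i)./2))); last first.
  by move=> i ->; rewrite mul0r.
rewrite coef_fpsM; apply: eq_bigr => i _.
by rewrite odd_double doubleK -doubleB odd_double doubleK.
Qed.
HB.instance Definition _ :=
  GRing.isZmodMorphism.Build (fps R) (fps R) fpsV fpsV_zmod.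
HB.instance Definition _ :=
  GRing.isMonoidMorphism.Build (fps R) (fps R) fpsV fpsV_monoid.

Lemma fpsV_X : fpsV fpsX = fpsX ^+ 2.
Proof.
apply/fpsP => n; rewrite coef_fpsXn /=.
by case: n => [|[|[|[|n]]]] //=; do 4 case: odd => //=.
Qed.

Lemma fpsD_V x : fpsD (fpsV x) = 2%:R * fpsV (fpsD x).
Proof.
rewrite mulr_natl; apply/fpsP => n; rewrite coef_fpsMn coef_D !coef_V coef_D.
case: ifP => on; first by rewrite !mul0rn.
by rewrite -mulrnA muln2; congr (_ *+ _); have := odd_double_half n; rewrite on.
Qed.

(** Odd coefficients vanish and the one at an even n > 0 equals the one at n/2, so descent applies.
    This is how invariance under V yields [fpsD_lambda] and [phi_hasse]. *)
Lemma fpsV_fixed x : fpsV x = x -> x = fpsC (coef x 0).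
Proof.
move=> Vx; apply/fpsP; elim/ltn_ind => -[|n] // IH.
rewrite -Vx /=; case: ifP => // on; rewrite IH; last by rewrite ltnS; lia.
by case: n {IH} on.
Qed.

End FpsMaps.
Arguments fpsD {R}.
Arguments fpsV {R}.

(** * Theta series and the Euler product *)

Arguments coef : simpl never.

Section Euler.
Variable R : comNzRingType.

Lemma fps_eqmod_trans N (x y z : fps R) :
  fps_eqmod N x y -> fps_eqmod N y z -> fps_eqmod N x z.
Proof. by move=> xy yz n nN; rewrite xy ?yz. Qed.

Lemma fps_eqmod_sym N (x y : fps R) : fps_eqmod N x y -> fps_eqmod N y x.
Proof. by move=> xy n nN; rewrite xy. Qed.

Lemma fps_eqmod_le M N (x y : fps R) :
  (N <= M)%N -> fps_eqmod M x y -> fps_eqmod N x y.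
Proof. by move=> NM xy n nN; apply: xy; apply: leq_trans NM. Qed.

Lemma fps_eqmodB0 N (x y : fps R) : fps_eqmod N (x - y) 0 -> fps_eqmod N x y.
Proof. by move=> h n nN; apply/eqP; rewrite -subr_eq0 -coef_fpsB h. Qed.

Lemma fps_eqmod_sum N I (r : seq I) (P : pred I) (F G : I -> fps R) :
  (forall i, P i -> fps_eqmod N (F i) (G i)) ->
  fps_eqmod N (\sum_(i <- r | P i) F i) (\sum_(i <- r | P i) G i).
Proof.
by move=> FG n nN; rewrite !coef_fps_sum; apply: eq_bigr => i /FG ->.
Qed.

Lemma fps_eq_eqmod (x y : fps R) : (forall N, fps_eqmod N x y) -> x = y.
Proof. by move=> h; apply/fpsP => n; apply: (h n.+1). Qed.

Lemma fps_eqmodXM N k (x y : fps R) :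
  fps_eqmod (N - k) x y -> fps_eqmod N (fpsX ^+ k * x) (fpsX ^+ k * y).
Proof.
move=> h n nN; rewrite !coef_fpsXnM; case: ltnP => // kn.
by apply: h; rewrite ltn_sub2r // (leq_ltn_trans kn).
Qed.

Lemma fps_eqmodV N (x y : fps R) :
  fps_eqmod N x y -> fps_eqmod N.*2 (fpsV x) (fpsV y).
Proof. by move=> h n nN; rewrite !coef_V; case: ifP => // _; apply: h; lia. Qed.

Definition euler_prod (Q : fps R) N := \prod_(i < N) (1 - Q ^+ i.+1).

Lemma euler_prodS Q N :
  euler_prod Q N.+1 = euler_prod Q N * (1 - Q ^+ N.+1).
Proof. by rewrite /euler_prod big_ord_recr. Qed.

(** Factors beyond the n-th do not affect the coefficient of q^n, so the infinite product is encoded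
    by the diagonal of its partial products. *)
Definition euler : fps R := Fps (fun n => coef (euler_prod fpsX n) n).

Lemma euler_prod_stable M N :
  (M <= N)%N -> fps_eqmod M.+1 (euler_prod fpsX N) (euler_prod fpsX M).
Proof.
elim: N => [|N IH]; first by rewrite leqn0 => /eqP ->.
rewrite leq_eqVlt ltnS => /orP[/eqP -> //|MN]; move: (IH MN).
apply: fps_eqmod_trans; apply: fps_eqmodB0 => n nM.
rewrite euler_prodS mulrBr mulr1 addrAC subrr add0r coef_fpsN mulrC.
by rewrite coef_fpsXnM (leq_trans nM) ?oppr0 // ltnS.
Qed.

Lemma eulerP N : fps_eqmod N.+1 euler (euler_prod fpsX N).
Proof. by move=> n nN; rewrite /coef /= -!/(coef _ _) (@euler_prod_stable n N). Qed.

Lemma coef0_fpsM (x y : fps R) : coef (x * y) 0 = coef x 0 * coef y 0.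
Proof. by rewrite coef_fpsM big_ord1. Qed.

Lemma coef0_fps_exp (x : fps R) k : coef (x ^+ k) 0 = coef x 0 ^+ k.
Proof. by elim: k => // k IH; rewrite !exprS coef0_fpsM IH. Qed.

Lemma coef0_euler : coef euler 0 = 1.
Proof. by rewrite /coef /= /euler_prod big_ord0. Qed.

Fixpoint gauss_binom (Q : fps R) N j : fps R :=
  match N, j with
  | _, 0 => 1
  | 0, _.+1 => 0
  | N.+1, j.+1 => gauss_binom Q N j.+1 + Q ^+ (N - j) * gauss_binom Q N j
  end.

Lemma gauss_binom0 Q N : gauss_binom Q N 0 = 1. Proof. by case: N. Qed.

Lemma gauss_binom_small Q N j : (N < j)%N -> gauss_binom Q N j = 0.
Proof.
elim: N j => [|N IH] [|j] //= Nj.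
by rewrite !IH ?mulr0 ?addr0 // ltnW.
Qed.

(** The quotient formula for Gaussian binomials, cleared of denominators and proved by induction on
    [a + b]. *)
Lemma gauss_binomE Q a b :
  gauss_binom Q (a + b) a * euler_prod Q a * euler_prod Q b =
  euler_prod Q (a + b).
Proof.
move: {2}(a + b)%N (leqnn (a + b)) => N.
elim: N a b => [|N IH] [|a] [|b] //=; rewrite ?gauss_binom0 //;
  try by rewrite /euler_prod big_ord0 !mul1r.
- rewrite addn0 ltnS => aN; rewrite gauss_binom_small ?addn0 // add0r.
  have := IH a 0%N; rewrite addn0 => /(_ aN) e.
  rewrite subnn expr0 mul1r !euler_prodS -{2}e; ring.
rewrite addSn addnS ltnS => abN.
have := IH a b.+1; have := IH a.+1 b.
rewrite addnS addSn => /(_ abN) e1 /(_ abN) e2.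
have -> : ((a + b).+1 - a)%N = b.+1 by lia.
rewrite [RHS]euler_prodS mulrDl mulrDl {1}[euler_prod Q b.+1]euler_prodS mulrA e1.
(* The new factor 1 - Q^(a+b+2) splits as (1 - Q^(b+1)) + Q^(b+1) (1 - Q^(a+1)), matching the two
   terms of the q-Pascal rule. *)
transitivity (euler_prod Q (a + b).+1 * (1 - Q ^+ b.+1) +
  Q ^+ b.+1 * (1 - Q ^+ a.+1) * euler_prod Q (a + b).+1).
  by rewrite -[in X in _ = _ + X]e2 [euler_prod Q a.+1]euler_prodS; ring.
have -> : (a + b).+2 = (a.+1 + b.+1)%N by rewrite addSn addnS.
by rewrite exprD; ring.
Qed.

(* Homogenized in x and y to avoid negative powers of q. *)
Lemma gauss_binom_thm Q x y N :
  \prod_(i < N) (y + x * Q ^+ i) =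
  \sum_(j < N.+1) Q ^+ 'C(j, 2) * gauss_binom Q N j * x ^+ j * y ^+ (N - j).
Proof.
elim: N => [|N IH]; first by rewrite big_ord0 big_ord1 /= !expr0 !mulr1.
rewrite big_ord_recr /= IH mulrDr.
rewrite [RHS]big_ord_recl.
under [in RHS]eq_bigr => j _ do
  rewrite /= /bump /= add1n mulrDr !mulrDl.
rewrite big_split /= addrA; congr (_ + _).
  rewrite [LHS]mulr_suml big_ord_recl big_ord_recr /= (@gauss_binom_small Q N N.+1) //.
    rewrite mulr0 !mul0r addr0; congr (_ + _).
      by rewrite gauss_binom0 !subn0 exprSr; ring.
    apply: eq_bigr => j _; rewrite /bump /= add1n subSS.
    have -> : (N - j = (N - j.+1).+1)%N by have := ltn_ord j; lia.
    by rewrite [y ^+ _.+1]exprS; ring.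
rewrite mulr_suml; apply: eq_bigr => j _; rewrite subSS.
have -> : 'C(j.+1, 2) = ('C(j, 2) + j)%N by rewrite binS bin1.
have -> : Q ^+ N = Q ^+ j * Q ^+ (N - j) by rewrite -exprD subnKC // -ltnS.
by rewrite !exprD exprS add0n; ring.
Qed.

(* The sum over all integers j of c(|j|) q^(j^2). *)
Definition theta (c : nat -> R) : fps R :=
  Fps (fun n => \sum_(j < n.+1) (c j *+ (j != 0 :> nat)%N.+1) *+ (n == j ^ 2)%N).

(** The index [a] stands for j + N with -N <= j <= N, so that a sum over integers runs over an
    ordinal. *)
Definition theta_part (c : nat -> R) N : fps R :=
  \sum_(a < N.*2.+1) fpsC (c `|a - N|%N) * fpsX ^+ (`|a - N| ^ 2)%N.

Lemma theta_partS c N : theta_part c N.+1 =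
  theta_part c N + fpsC (c N.+1 *+ 2) * fpsX ^+ (N.+1 ^ 2)%N.
Proof.
rewrite /theta_part doubleS big_ord_recl big_ord_recr /=.
rewrite subn0.
rewrite (_ : `|bump 0 N.*2.+1 - N.+1|%N = N.+1); last by rewrite /bump; lia.
rewrite addrCA rmorphMn mulrnAl mulr2n; congr (_ + _).
by apply: eq_bigr => a _; rewrite /bump (_ : `|1 + a - N.+1|%N = `|a - N|%N) //; lia.
Qed.

Lemma theta_partP c N : fps_eqmod N.+1 (theta c) (theta_part c N).
Proof.
have -> : theta_part c N =
    \sum_(j < N.+1) fpsC (c j *+ (j != 0 :> nat)%N.+1) * fpsX ^+ (j ^ 2)%N.
  elim: N => [|N IH]; last by rewrite big_ord_recr /= -IH theta_partS.
  by rewrite /theta_part !big_ord1.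
move=> n nN; rewrite coef_fps_sum [RHS](bigID (fun j : 'I_N.+1 => j < n.+1)%N) /=.
rewrite [X in _ + X]big1 ?addr0 => [|j nj]; last first.
  rewrite coef_fpsCM coef_fpsXn [n == _](_ : _ = false) ?mulr0 //.
  by apply/eqP => e; move: nj; rewrite -leqNgt e -mulnn; nia.
rewrite (big_ord_narrow nN) [LHS]/coef /=; apply: eq_bigr => j _ /=.
by rewrite coef_fpsCM coef_fpsXn mulr_natr.
Qed.

End Euler.

(** * Sums of two squares and the relations of the arithmetic-geometric mean *)

Section Lattice.
Variable R : comNzRingType.

(** Coordinates are shifted by [N] to fit into ordinals; for n <= N the box contains every integer
    point of x^2 + y^2 = n. *)
Definition on_circle N n (p : 'I_N.*2.+1 * 'I_N.*2.+1) : bool :=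
  (`|p.1 - N| ^ 2 + `|p.2 - N| ^ 2 == n)%N.

Lemma on_circleP N n (p : 'I_N.*2.+1 * 'I_N.*2.+1) :
  reflect ((p.1%:Z - N%:Z) ^+ 2 + (p.2%:Z - N%:Z) ^+ 2 = n%:Z)
    (on_circle n p).
Proof.
have sqrE (x : int) : (`|x| ^ 2)%N%:Z = x ^+ 2 by rewrite -mulnn; nia.
by apply: (iffP eqP); rewrite -!sqrE => e; lia.
Qed.

(** An integer is at most its square, so |x + y| and |x - y| are at most n. This keeps the map (u,
    v) |-> (u + v, u - v) inside the box. *)
Lemma on_circle_bound N n (p : 'I_N.*2.+1 * 'I_N.*2.+1) : on_circle n p ->
  (p.1 + p.2 <= N.*2 + n)%N /\ (N.*2 <= p.1 + p.2 + n)%N /\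
  (p.1 <= p.2 + n)%N /\ (p.2 <= p.1 + n)%N.
Proof.
move=> /on_circleP.
have le_sqr (z : int) : (z <= z ^+ 2)%R /\ (- z <= z ^+ 2)%R by nia.
have := le_sqr (p.1%:Z - N%:Z); have := le_sqr (p.2%:Z - N%:Z); lia.
Qed.

Lemma coef_thetaM (c c' : nat -> R) N n : (n <= N)%N ->
  coef (theta c * theta c') n =
  \sum_(p | @on_circle N n p) c `|p.1 - N|%N * c' `|p.2 - N|%N.
Proof.
move=> nN.
rewrite (fps_eqmodM (@theta_partP _ c N) (@theta_partP _ c' N)) //.
rewrite big_distrlr /= pair_big /= coef_fps_sum [RHS]big_mkcond.
apply: eq_bigr => -[a b] _ /=.
rewrite mulrACA -exprD -rmorphM coef_fpsCM coef_fpsXn eq_sym /on_circle /=.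
by case: eqP; rewrite ?mulr1 ?mulr0.
Qed.

(* The lattice points with both coordinates of the same parity form the
   image of the lattice under (u, v) |-> (u + v, u - v). *)
Lemma sum_circle_double (w : nat -> nat -> R) N k : (k.*2 <= N)%N ->
  \sum_(p | @on_circle N k.*2 p) w p.1 p.2 =
  \sum_(p | @on_circle N k p) w (p.1 + p.2 - N)%N (N + p.1 - p.2)%N.
Proof.
move=> kN.
pose h (p : 'I_N.*2.+1 * 'I_N.*2.+1) : 'I_N.*2.+1 * 'I_N.*2.+1 :=
  (inord (p.1 + p.2 - N), inord (N + p.1 - p.2)).
pose h' (p : 'I_N.*2.+1 * 'I_N.*2.+1) : 'I_N.*2.+1 * 'I_N.*2.+1 :=
  (inord (p.1 + p.2)./2, inord (p.1 + N.*2 - p.2)./2).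
have hE p : on_circle k p ->
    [/\ ((h p).1 = p.1 + p.2 - N :> nat)%N, ((h p).2 = N + p.1 - p.2 :> nat)%N,
        (N <= p.1 + p.2)%N & (p.2 <= N + p.1)%N].
  by move=> /on_circle_bound b; rewrite !inordK; try split => //; lia.
have h'E p : on_circle k.*2 p ->
    [/\ ((h' p).1 = (p.1 + p.2)./2 :> nat)%N,
        ((h' p).2 = (p.1 + N.*2 - p.2)./2 :> nat)%N & ~~ odd (p.1 + p.2)].
  case: p => a b /on_circleP /= e.
  have la := ltn_ord a; have lb := ltn_ord b.
  rewrite !inordK; try by lia.
  split=> //; apply/negP => o.
  have [j ej] : exists j, (a + b = j.*2.+1)%N.
    by exists (a + b)./2; rewrite -{1}[(a + b)%N]odd_double_half o.
  have : (a%:Z - N%:Z + (b%:Z - N%:Z) = (j%:Z - N%:Z) * 2 + 1)%R by lia.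
  move: e; set x := a%:Z - _; set y := b%:Z - _; set z := (j%:Z - _).
  move=> e /(congr1 (fun t => t ^+ 2)) /=.
  have -> : (x + y) ^+ 2 = k.*2%:Z + (x * y) * 2 by rewrite -e; ring.
  have -> : (z * 2 + 1) ^+ 2 = (z ^+ 2 + z) * 4 + 1 by ring.
  set t := _ ^+ 2 + _; set t' := _ * y; lia.
have hP p : on_circle k p -> on_circle k.*2 (h p).
  move=> cp; have [e1 e2 b1 b2] := hE p cp; apply/on_circleP; rewrite e1 e2.
  have -> : (p.1 + p.2 - N)%N%:Z - N%:Z =
    (p.1%:Z - N%:Z) + (p.2%:Z - N%:Z) by lia.
  have -> : (N + p.1 - p.2)%N%:Z - N%:Z =
    (p.1%:Z - N%:Z) - (p.2%:Z - N%:Z) by lia.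
  move/on_circleP: cp => cp; have -> : k.*2%:Z = 2 * k%:Z by lia.
  rewrite -cp; ring.
have h'P p : on_circle k.*2 p -> on_circle k (h' p).
  move=> cp; have [e1 e2 o] := h'E p cp; apply/on_circleP; rewrite e1 e2.
  have [j ej] : exists j, (p.1 + p.2 = j.*2)%N.
    by exists (p.1 + p.2)./2; rewrite -{1}[(p.1 + p.2)%N]odd_double_half (negbTE o).
  have l2 := ltn_ord p.2.
  have x1 : (p.1 + p.2)./2%:Z - N%:Z = j%:Z - N%:Z by lia.
  have x2 : (p.1 + N.*2 - p.2)./2%:Z - N%:Z = p.1%:Z - j%:Z by lia.
  move/on_circleP: cp; have -> : (p.2%:Z = j%:Z * 2 - p.1%:Z)%R by lia.
  have -> : k.*2%:Z = 2 * k%:Z by lia.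
  rewrite x1 x2 => cp; apply: (@mulfI _ 2%:Z) => //.
  rewrite -cp; ring.
rewrite (reindex_onto h h') => [|p cp]; last first.
  have [e1 e2 o] := h'E p cp; have [f1 f2 b1 b2] := hE _ (h'P p cp).
  have l1 := ltn_ord p.1; have l2 := ltn_ord p.2.
  by case: p cp o e1 e2 f1 f2 b1 b2 l1 l2 => a b /= *;
    congr pair; apply: val_inj => /=; lia.
apply: eq_big => [p|p /andP[cp /eqP e]].
  apply/andP/idP => [[cp /eqP <-]|cp]; first exact: h'P.
  split; first exact: hP.
  have [e1 e2 o] := h'E _ (hP p cp); have [f1 f2 b1 b2] := hE _ cp.
  apply/eqP; have l1 := ltn_ord p.1; have l2 := ltn_ord p.2.
  by case: p cp o e1 e2 f1 f2 b1 b2 l1 l2 => a b /= *;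
    congr pair; apply: val_inj => /=; lia.
have [|f1 f2 b1 b2] := hE p; last by rewrite f1 f2.
by rewrite -e; exact: h'P.
Qed.

Lemma on_circle_odd N n (p : 'I_N.*2.+1 * 'I_N.*2.+1) : on_circle n p ->
  odd (`|p.1 - N| + `|p.2 - N|) = odd n.
Proof. by move=> /eqP <-; rewrite !oddD !oddX. Qed.

Lemma sign_theta (a b : nat) : (-1) ^+ a * (-1) ^+ b = (-1) ^+ odd (a + b) :> R.
Proof. by rewrite signr_odd exprD. Qed.

Definition phi : fps R := theta (fun=> 1).
Definition phim : fps R := theta (fun n => (-1) ^+ n).

(** The coefficient at q^n on the left sums 1 + (-1)^(x+y) over the circle of n, and x + y has the
    parity of n. Odd n cancel; for even n the circle is the image of that of n/2. *)
Lemma phi_sqr_phim_sqr : phi ^+ 2 + phim ^+ 2 = 2%:R * fpsV phi ^+ 2.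
Proof.
apply/fpsP => n; rewrite -rmorphXn mulr_natl coef_fpsMn coef_V !expr2 coef_fpsD.
rewrite !(@coef_thetaM _ _ n); try lia.
rewrite -[LHS]big_split /=.
under eq_bigr => p cp do rewrite sign_theta (on_circle_odd cp) mulr1.
case: ifP => [on|/negbT on].
  by rewrite big1 ?mul0rn // => p _; rewrite subrr.
have en : n = n./2.*2 by lia.
rewrite -sumrMnl; move: (n./2) en => k en; rewrite en in on *.
rewrite (sum_circle_double (fun _ _ => 1 + 1)); last by lia.
by apply: eq_bigr => p _; rewrite mulr1 mulr2n.
Qed.

(** The coefficient at q^n on the left sums (-1)^y over the circle of n. For odd n exactly one
    coordinate is odd and swapping them cancels the sum; for even n, y = u - v has the parity of u +
    v, which gives the sign of [phim ^+ 2] at n/2. *)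
Lemma phi_phim : phi * phim = fpsV phim ^+ 2.
Proof.
apply/fpsP => n; rewrite -rmorphXn coef_V expr2 (@coef_thetaM _ _ n) //.
under eq_bigr => p cp do rewrite mul1r.
case: ifP => [on|/negbT on].
  rewrite (bigID (fun p : 'I_n.*2.+1 * 'I_n.*2.+1 => odd `|p.2 - n|%N)) /=.
  rewrite [X in _ + X](reindex_inj (inv_inj swap_pairK)) /=.
  rewrite [X in _ + X](eq_bigl (fun p : 'I_n.*2.+1 * 'I_n.*2.+1 =>
    on_circle n p && odd `|p.2 - n|%N)) => [|p].
    rewrite -[LHS]big_split big1 //= => p /andP[cp op].
    rewrite -[X in X + _]signr_odd -[X in _ + X]signr_odd op.
    have := on_circle_odd cp; rewrite on oddD op.
    by case: odd => // _; rewrite expr0 expr1 addNr.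
  rewrite [X in X && _](_ : _ = on_circle n p); last by rewrite /on_circle addnC.
  case cp: (on_circle n p) => //=.
  by have := on_circle_odd cp; rewrite on oddD; do 2 case: odd.
have en : n = n./2.*2 by lia.
rewrite (@coef_thetaM _ _ n); last by lia.
have := @sum_circle_double (fun _ b => (-1) ^+ `|b - n|%N) n n./2.
rewrite -en => -> //; apply: eq_bigr => p cp; rewrite sign_theta.
rewrite -[LHS]signr_odd; congr (_ ^+ nat_of_bool _).
move: (on_circle_bound cp); case: p {cp} => u v /= b.
have -> : `|(n + u - v)%N%:Z - n%:Z|%N = `|u%:Z - v%:Z|%N by lia.
lia.
Qed.
End Lattice.

(** * A finite Jacobi triple product and Gauss's formula for [phim] *)

Section Gauss.
Variable R : comNzRingType.
Local Notation X := (@fpsX R).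

Lemma fpsXn_inj k (x y : fps R) : X ^+ k * x = X ^+ k * y -> x = y.
Proof.
move=> /fpsP e; apply/fpsP => n; have := e (n + k)%N.
by rewrite !coef_fpsXnM ltnNge leq_addl /= addnK.
Qed.

Lemma prod_const_ord (x : fps R) n : \prod_(i < n) x = x ^+ n.
Proof. by rewrite prodr_const card_ord. Qed.

Definition odd_prod M : fps R := \prod_(i < M) (1 - X ^+ i.*2.+1).

Lemma euler_prod_odd M :
  euler_prod X M.*2 = odd_prod M * euler_prod (X ^+ 2) M.
Proof.
elim: M => [|M IH]; first by rewrite /odd_prod /euler_prod !big_ord0 mulr1.
rewrite doubleS !euler_prodS IH /odd_prod big_ord_recr /= -exprM mul2n doubleS.
by ring.
Qed.

Lemma euler_prodV M : euler_prod (X ^+ 2) M = fpsV (euler_prod X M).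
Proof.
rewrite /euler_prod rmorph_prod; apply: eq_bigr => i _.
by rewrite rmorphB rmorph1 rmorphXn /= fpsV_X.
Qed.

(** A finite Jacobi triple product: the q-binomial theorem with base q^2, x = -1 and y = q^(2M+1),
    whose 2M + 2 factors are, up to signs and powers of q, those of [odd_prod] taken twice. *)
Lemma odd_prod_sqr M : odd_prod M.+1 ^+ 2 =
  \sum_(j < M.+1.*2.+1) fpsC ((-1) ^+ `|j%:Z - M.+1%:Z|%N) *
     (X ^+ (`|j%:Z - M.+1%:Z| ^ 2)%N * gauss_binom (X ^+ 2) M.+1.*2 j).
Proof.
(* The factors with i <= M contribute q^((M+1)M) and the others q^((M+1)(2M+1)). *)
apply: (@fpsXn_inj (M.+1 * M + M.+1 * M.*2.+1)%N).
have := gauss_binom_thm (X ^+ 2) (-1) (X ^+ M.*2.+1) M.+1.*2.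
have -> : \prod_(i < M.+1.*2) (X ^+ M.*2.+1 + -1 * X ^+ 2 ^+ i) =
    (-1) ^+ M.+1 * X ^+ (M.+1 * M + M.+1 * M.*2.+1) * odd_prod M.+1 ^+ 2.
  rewrite -addnn big_split_ord /=.
  have -> : \prod_(i < M.+1) (X ^+ M.*2.+1 + -1 * X ^+ 2 ^+ (M.+1 + i)) =
     X ^+ (M.+1 * M.*2.+1) * odd_prod M.+1.
    rewrite mulnC exprM -(prod_const_ord (X ^+ _)) -[RHS]big_split /=.
    apply: eq_bigr => i _; rewrite mulrBr mulr1 -exprM -exprD mulN1r.
    by congr (_ - X ^+ _); lia.
  have -> : \prod_(i < M.+1) (X ^+ M.*2.+1 + -1 * X ^+ 2 ^+ i) =
     (-1) ^+ M.+1 * X ^+ (M.+1 * M) * odd_prod M.+1.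
    rewrite /odd_prod (reindex_inj rev_ord_inj) /=.
    have -> : X ^+ (M.+1 * M) = \prod_(i < M.+1) X ^+ (M - i).*2.
      transitivity (\prod_(i < M.+1) X ^+ i.*2).
        elim: {+}M => [|k IH]; first by rewrite muln0 big_ord1.
        by rewrite big_ord_recr /= -IH -exprD; congr (_ ^+ _); lia.
      rewrite (reindex_inj rev_ord_inj); apply: eq_bigr => i _ /=.
      by rewrite subSS.
    rewrite -(prod_const_ord (-1)) -[X in X * _]big_split -[RHS]big_split /=.
    apply: eq_bigr => i _; rewrite -exprM subSS mul2n.
    have -> : M.*2.+1 = ((M - i).*2 + i.*2.+1)%N by have := ltn_ord i; lia.
    by rewrite exprD; ring.
  by rewrite exprD; ring.
move=> e; apply: (@mulrI _ ((-1) ^+ M.+1)); first exact: unitrX (unitrN1 _).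
rewrite mulrA e !mulr_sumr; apply: eq_bigr => j _.
have lj := ltn_ord j.
rewrite -!exprM.
have -> : (-1) ^+ j = (-1) ^+ M.+1 * (-1) ^+ `|j%:Z - M.+1%:Z|%N :> fps R.
  by rewrite -exprD -[LHS]signr_odd -[RHS]signr_odd; congr (_ ^+ nat_of_bool _); lia.
rewrite rmorphXn rmorphN1; set s := (-1) ^+ `|_|%N.
transitivity ((-1) ^+ M.+1 * s * gauss_binom (X ^+ 2) M.+1.*2 j *
  (X ^+ (2 * 'C(j, 2)) * X ^+ (M.*2.+1 * (M.+1.*2 - j)))); first by ring.
rewrite -exprD.
(* Completing the square in j produces the theta exponent. *)
have -> : (2 * 'C(j, 2) + M.*2.+1 * (M.+1.*2 - j) =
  M.+1 * M + M.+1 * M.*2.+1 + `|j%:Z - M.+1%:Z| ^ 2)%N.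
  have -> : (2 * 'C(j, 2) = j * j.-1)%N by rewrite mulnC (bin_ffact j 2) ffactnS ffactn1.
  rewrite -mulnn; move: (nat_of_ord j) lj => k; clear; rewrite ltnS => kM.
  have [Mk|kM1] := leqP M.+1 k.
    have [d ed] : exists d, k = (M.+1 + d)%N by exists (k - M.+1)%N; lia.
    have [r er] : exists r, M.+1 = (d + r)%N by exists (M.+1.*2 - k)%N; lia.
    have -> : `|k%:Z - M.+1%:Z|%N = d by lia.
    have -> : (M.+1.*2 - k = r)%N by lia.
    have -> : k.-1 = (M + d)%N by lia.
    by nia.
  have [d ed] : exists d, M.+1 = (k + d.+1)%N by exists (M - k)%N; lia.
  have -> : `|k%:Z - M.+1%:Z|%N = d.+1 by lia.
  have -> : (M.+1.*2 - k = M.+1 + d.+1)%N by lia.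
  have -> : (k * k.-1 = k * k - k)%N by case: (k) => //= n; lia.
  by nia.
by rewrite exprD; ring.
Qed.

(** All three products in [gauss_binomE] approximate E(q^2). The precision is what remains of 2M
    after the later multiplication by q^((j-M)^2). *)
Lemma gauss_binom_euler M (j : 'I_M.*2.+1) :
  fps_eqmod (M.*2 - `|j%:Z - M%:Z| ^ 2)
    (gauss_binom (X ^+ 2) M.*2 j * fpsV (@euler R) ^+ 2) (fpsV (@euler R)).
Proof.
have eV a : fps_eqmod a.+1.*2 (fpsV (@euler R)) (euler_prod (X ^+ 2) a).
  by rewrite euler_prodV; apply: fps_eqmodV; exact: eulerP.
have lj := ltn_ord j.
pose N := (M.*2 - `|j%:Z - M%:Z| ^ 2)%N.
have le1 : (N <= j.+1.*2)%N by rewrite /N -mulnn; nia.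
have le2 : (N <= (M.*2 - j).+1.*2)%N by rewrite /N -mulnn; nia.
have le3 : (N <= M.*2.+1.*2)%N by rewrite /N; lia.
have := fps_eqmodM (x := gauss_binom (X ^+ 2) M.*2 j) (fun _ _ => erefl)
  (fps_eqmodM (fps_eqmod_le le1 (@eV j)) (fps_eqmod_le le2 (@eV (M.*2 - j)%N))).
have := gauss_binomE (X ^+ 2) j (M.*2 - j); rewrite subnKC ?mulrA -1?ltnS // => ->.
move=> h; apply: fps_eqmod_trans h _ => //.
by apply: fps_eqmod_sym; apply: fps_eqmod_le le3 _.
Qed.

(** Gauss's product formula as the limit of [odd_prod_sqr]: the odd product times E(q^2) tends to E,
    and [gauss_binom_euler] turns the finite sum into the theta series. *)
Lemma phim_euler : phim R * fpsV (@euler R) = @euler R ^+ 2.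
Proof.
apply: fps_eq_eqmod => N.
have oe : fps_eqmod N.+1.*2 (odd_prod N.+1 * fpsV (@euler R)) (@euler R).
  apply: fps_eqmod_trans (fps_eqmod_sym (fps_eqmod_le _ (@eulerP R N.+1.*2))) => //.
  rewrite euler_prod_odd euler_prodV; apply: fps_eqmodM => //.
  by apply: (fps_eqmod_le _ (fps_eqmodV (@eulerP R N.+1))); lia.
have := fps_eqmodX 2 oe; rewrite exprMn odd_prod_sqr mulr_suml => h.
have : fps_eqmod N (theta_part (fun n => (-1) ^+ n) N.+1 * fpsV (@euler R))
    (@euler R ^+ 2).
  apply: fps_eqmod_trans (fps_eqmod_le _ h); last by lia.
  rewrite mulr_suml; apply: fps_eqmod_sum => j _; rewrite -!mulrA.
  apply: fps_eqmodM => //; apply: fps_eqmodXM; apply: fps_eqmod_sym.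
  by apply: (fps_eqmod_le _ (@gauss_binom_euler N.+1 j)); lia.
apply: fps_eqmod_trans; apply: fps_eqmodM => //.
by apply: (fps_eqmod_le _ (@theta_partP _ _ N.+1)); lia.
Qed.
End Gauss.

(** * The modular relations *)

Lemma eq_subr0 (V : zmodType) (x y : V) : x = y -> x - y = 0.
Proof. by move=> ->; rewrite subrr. Qed.

Section Units.
Variable K : fieldType.

(** Sum the geometric series of [h = 1 - x / c], where c is the constant term of x; it converges
    since h^k has no terms below q^k. *)
Lemma fps_unit_coef0 (x : fps K) : coef x 0 != 0 -> x \is a GRing.unit.
Proof.
move=> x0; pose h : fps K := 1 - fpsC (coef x 0)^-1 * x.
have h0 : coef h 0 = 0.
  by rewrite coef_fpsB coef_fpsCM coef_fps1 mulVf ?subrr.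
have hX k n : (n < k)%N -> coef (h ^+ k) n = 0.
  elim: k n => // k IH n nk; rewrite exprS coef_fpsM big1 // => -[[|i] /= hi] _.
    by rewrite h0 mul0r.
  by rewrite IH ?mulr0 //; lia.
pose G N := \sum_(i < N) h ^+ i.
pose y : fps K := Fps (fun n => coef (G n.+1) n).
have Gy N : fps_eqmod N y (G N).
  elim: N => // N IH n; rewrite ltnS leq_eqVlt => /orP[/eqP ->|nN].
    by rewrite [LHS]/coef.
  by rewrite (IH n nN) /G big_ord_recr coef_fpsD hX ?addr0.
have y1 : y * (1 - h) = 1.
  apply: fps_eq_eqmod => N; apply: fps_eqmod_trans (fps_eqmodM (@Gy N) _) _.
    by move=> n _; reflexivity.
  have -> : G N * (1 - h) = 1 - h ^+ N.
    by rewrite -[RHS]opprB subrX1 -/(G N); ring.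
  by move=> n nN; rewrite coef_fpsB hX ?subr0.
have : (y * fpsC (coef x 0)^-1) * x = 1.
  by rewrite -mulrA -[RHS]y1; congr (_ * _); rewrite /h; ring.
by move=> e; apply/unitrP; exists (y * fpsC (coef x 0)^-1); rewrite e mulrC.
Qed.

Lemma fps_coef0_neq0 (x : fps K) n : coef x n != 0 -> x != 0.
Proof. by apply: contraNneq => ->. Qed.

Lemma fpsV_inj : injective (@fpsV K).
Proof.
move=> x y /fpsP e; apply/fpsP => n; have := e n.*2.
by rewrite !coef_V odd_double doubleK.
Qed.

Lemma fps_coef0_X (x : fps K) : coef x 0 = 0 ->
  exists2 y, x = fpsX * y & coef y 0 = coef x 1.
Proof.
move=> x0; exists (Fps (fun n => coef x n.+1)); last by [].
by apply/fpsP => -[|n]; rewrite coef_fpsXM.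
Qed.

Lemma coef1_fpsM (x y : fps K) :
  coef (x * y) 1 = coef x 0 * coef y 1 + coef x 1 * coef y 0.
Proof. by rewrite coef_fpsM big_ord_recl big_ord1. Qed.

Lemma coef1_fps_exp (x : fps K) k : coef x 0 = 1 ->
  coef (x ^+ k) 1 = k%:R * coef x 1.
Proof.
move=> x0; elim: k => [|k IH]; first by rewrite mul0r.
rewrite exprS coef1_fpsM IH x0 mul1r coef0_fps_exp x0 expr1n mulr1 -natr1; ring.
Qed.

Lemma fpsV_natMX k (x : fps K) n :
  fpsV (k%:R * x ^+ n) = k%:R * fpsV x ^+ n.
Proof. by rewrite rmorphM rmorph_nat rmorphXn. Qed.

(** With [h = x - 1] the relation reads h^2 + 2h = V(h), which determines each coefficient of h from
    lower ones because 2 is invertible. *)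
Lemma fps_sqr_V (x : fps K) : 2%:R != 0 :> K -> coef x 0 = 1 ->
  x ^+ 2 = fpsV x -> x = 1.
Proof.
move=> two0 x0 e; pose h := x - 1.
suff h0 n : coef h n = 0 by apply/eqP; rewrite -subr_eq0; apply/eqP/fpsP.
elim/ltn_ind: n => -[_|n IH]; first by rewrite coef_fpsB x0 coef_fps1 subrr.
have : h ^+ 2 + h *+ 2 = fpsV h.
  by rewrite /h rmorphB rmorph1 /= -e; ring.
move=> /fpsP /(_ n.+1); rewrite coef_fpsD coef_fpsMn expr2 coef_fpsM big1.
  rewrite add0r coef_V => e1.
  apply: (mulfI two0); rewrite mulr0 mulr_natl e1.
  by case: ifP => // _; apply: IH; lia.
move=> [i hi] _ /=; case: (ltnP i n.+1) => ni; first by rewrite IH ?mul0r.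
by rewrite [coef h (_ - _)]IH ?mulr0 //; lia.
Qed.

(** Differentiate the hypothesis, multiply by 1 + k and eliminate l (1 + k)^2. *)
Lemma fpsD_quadratic (l k : fps K) : l * (1 + k) ^+ 2 = 4%:R * k ->
  fpsD l * (1 + k) ^+ 3 = 4%:R * fpsD k * (1 - k).
Proof.
move=> lk; have /(congr1 fpsD) := lk.
rewrite [fpsD (l * _)]fpsD_mul fpsD_exp fpsD_mul fpsD_nat fpsD_add.
rewrite (fpsD_nat K 1) /= => /eq_subr0 e.
apply/subr0_eq; rewrite -[RHS](mulr0 (1 + k)) -e.
have -> : 4%:R * fpsD k * (1 - k) =
    4%:R * fpsD k * (1 + k) - 2%:R * (4%:R * k) * fpsD k by ring.
by rewrite -lk; ring.
Qed.

End Units.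

Section Theta.
Variable K : fieldType.
Hypothesis two0 : 2%:R != 0 :> K.

Let P := fpsV (phi K).
Let phi := phi K.
Let m := phim K.
Let E4 := fpsV (fpsV (@euler K)).

Lemma coef0_theta (c : nat -> K) : coef (theta c) 0 = c 0%N.
Proof. by rewrite /coef /= big_ord1. Qed.
Lemma coef1_theta (c : nat -> K) : coef (theta c) 1 = c 1%N *+ 2.
Proof. by rewrite /coef /= big_ord_recl big_ord1 /= add0r. Qed.

Lemma phi_neq0 : phi != 0.
Proof. by apply: (@fps_coef0_neq0 _ _ 0); rewrite coef0_theta oner_eq0. Qed.
Lemma phim_neq0 : m != 0.
Proof. by apply: (@fps_coef0_neq0 _ _ 0); rewrite coef0_theta oner_eq0. Qed.
Lemma phi_unit : phi \is a GRing.unit.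
Proof. by apply: fps_unit_coef0; rewrite coef0_theta oner_eq0. Qed.

Lemma fpsV_eq0 (x : fps K) : x != 0 -> fpsV x != 0.
Proof. by apply: contraNneq => e; apply/eqP/fpsV_inj; rewrite e rmorph0. Qed.

Lemma fpsV_phi_neq0 : P != 0.
Proof. exact: fpsV_eq0 phi_neq0. Qed.

(* This is lambda(2z) for the modular lambda function. *)
Definition lambda : fps K := 1 - (m / phi) ^+ 4.

(** The elliptic modulus with square [fpsV lambda]; in terms of it [phi ^+ 2] and [phim ^+ 2] are
    P^2 (1 + kappa) and P^2 (1 - kappa). *)
Definition kappa : fps K := (phi ^+ 2 - m ^+ 2) / (2%:R * P ^+ 2).

Lemma lambdaE : phi ^+ 4 * lambda = phi ^+ 4 - m ^+ 4.
Proof.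
rewrite /lambda mulrBr mulr1 -exprMn [phi * _]mulrC.
by rewrite divrK // phi_unit.
Qed.

Lemma fps_two_unit : (2%:R : fps K) \is a GRing.unit.
Proof. by apply: fps_unit_coef0; rewrite -(rmorph_nat (@fpsC K)). Qed.

Lemma kappaE : P ^+ 2 * kappa *+ 2 = phi ^+ 2 - m ^+ 2.
Proof.
rewrite -mulr_natl /kappa mulrA [X in X = _]mulrC divrK // unitrM fps_two_unit unitrX //.
by apply: fps_unit_coef0; rewrite coef_V coef0_theta oner_eq0.
Qed.

Let phi_sqr : phi ^+ 2 + m ^+ 2 = 2%:R * P ^+ 2 := phi_sqr_phim_sqr K.
Let phi_m : phi * m = fpsV m ^+ 2 := phi_phim K.

Lemma phi_sqrE : phi ^+ 2 = P ^+ 2 * (1 + kappa).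
Proof.
apply: (mulrI fps_two_unit).
transitivity (phi ^+ 2 + m ^+ 2 + (phi ^+ 2 - m ^+ 2)); first by ring.
by rewrite -kappaE phi_sqr; ring.
Qed.

Lemma phim_sqrE : m ^+ 2 = P ^+ 2 * (1 - kappa).
Proof.
apply: (mulrI fps_two_unit).
transitivity (phi ^+ 2 + m ^+ 2 - (phi ^+ 2 - m ^+ 2)); first by ring.
by rewrite -kappaE phi_sqr; ring.
Qed.

Lemma fpsV_lambda : fpsV lambda = kappa ^+ 2.
Proof.
apply: (mulfI (expf_neq0 4 fpsV_phi_neq0)).
rewrite -{1}[P ^+ 4]rmorphXn -[LHS]rmorphM lambdaE rmorphB !rmorphXn /=.
rewrite -/P -[4%N]/(2 * 2)%N [fpsV m ^+ _]exprM -phi_m exprMn phi_sqrE phim_sqrE.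
by ring.
Qed.

(** Landen's transformation, relating the moduli at q and q^2. *)
Lemma lambda_kappa : lambda * (1 + kappa) ^+ 2 = 4%:R * kappa.
Proof.
apply: (mulfI (expf_neq0 4 fpsV_phi_neq0)).
transitivity ((phi ^+ 2) ^+ 2 * lambda); first by rewrite phi_sqrE; ring.
by rewrite -exprM lambdaE -[4%N]/(2 * 2)%N !exprM phi_sqrE phim_sqrE; ring.
Qed.

Lemma coef0_lambda : coef lambda 0 = 0.
Proof.
have /fpsP/(_ 0%N) := lambdaE.
rewrite coef0_fpsM coef_fpsB !coef0_fps_exp !coef0_theta /= expr1n mul1r => ->.
by rewrite coef_fpsB !coef0_fps_exp !coef0_theta /= expr0 !expr1n subrr.
Qed.

Lemma coef1_lambda : coef lambda 1 = 16%:R.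
Proof.
have /fpsP/(_ 1%N) := lambdaE.
rewrite [LHS]coef1_fpsM [RHS]coef_fpsB coef0_lambda mulr0 addr0 coef0_fps_exp.
rewrite !coef1_fps_exp ?coef0_theta //= expr1n mul1r => ->.
by rewrite !coef1_theta /= expr1; ring.
Qed.

Lemma lambda_neq0 : lambda != 0.
Proof.
apply: (@fps_coef0_neq0 _ _ 1); rewrite coef1_lambda.
by rewrite -[16%N]/(2 ^ 4)%N natrX expf_neq0.
Qed.

Lemma kappa_neq0 : kappa != 0.
Proof.
have := fpsV_eq0 lambda_neq0.
by rewrite fpsV_lambda expf_eq0.
Qed.

(* The quotient v of the two sides is a power series with constant term 1
   which, by the quadratic transformation, satisfies v(q) = v(q^2). *)
Lemma fpsD_lambda : fpsD lambda = lambda * m ^+ 4.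
Proof.
(* [lambda] has no constant term and is not invertible, so its factor q is split off before
   dividing. *)
have [l0 el c0] := fps_coef0_X coef0_lambda.
have um : l0 * m ^+ 4 \is a GRing.unit.
  apply: fps_unit_coef0; rewrite coef0_fpsM coef0_fps_exp coef0_theta expr1n.
  by rewrite mulr1 c0 coef1_lambda -[16%N]/(2 ^ 4)%N natrX expf_neq0.
have [v ev] : exists v, v * (l0 * m ^+ 4) = l0 + fpsD l0.
  by exists ((l0 + fpsD l0) / (l0 * m ^+ 4)); rewrite divrK.
have vE : fpsD lambda = v * (lambda * m ^+ 4).
  have -> : v * (lambda * m ^+ 4) = fpsX * (v * (l0 * m ^+ 4)) by rewrite el; ring.
  rewrite ev el fpsD_mul mulrDr; congr (_ * _ + _).
  by apply/fpsP => n; rewrite coef_D /coef /=; case: eqP => [->|_] //; rewrite mul0rn.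
have v0 : coef v 0 = 1.
  have /fpsP/(_ 0%N) := ev.
  rewrite coef0_fpsM (coef0_fpsM l0) coef0_fps_exp coef0_theta expr1n mulr1 coef_fpsD coef_D.
  rewrite mulr0n addr0 -[X in _ = X]mul1r; apply: mulIf.
  by rewrite c0 coef1_lambda -[16%N]/(2 ^ 4)%N natrX expf_neq0.
have k1 : 1 + kappa != 0.
  have := expf_neq0 2 phi_neq0; rewrite phi_sqrE mulf_eq0 negb_or.
    by case/andP.
have m0 := phim_neq0.
(* Differentiating V(lambda) = kappa^2 expresses D kappa through V(v), while Landen's transformation
   links it to D lambda and so to v. *)
have Dk : fpsD kappa = fpsV v * (kappa * phi ^+ 2 * m ^+ 2).
  apply: (mulfI kappa_neq0); apply: (mulrI fps_two_unit).
  transitivity (fpsD (fpsV lambda)).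
    by rewrite fpsV_lambda fpsD_exp expr1; ring.
  rewrite fpsD_V vE rmorphM rmorphM /= fpsV_lambda rmorphXn /=.
  rewrite -[4%N]/(2 * 2)%N [fpsV m ^+ _]exprM -phi_m; ring.
have Vv : fpsV v = v.
  have e1 : fpsD lambda * (1 + kappa) ^+ 3 = 4%:R * fpsD kappa * (1 - kappa).
    exact: fpsD_quadratic lambda_kappa.
  have nz : kappa * m ^+ 4 * (1 + kappa) != 0.
    by apply: mulf_neq0 (mulf_neq0 kappa_neq0 (expf_neq0 _ m0)) k1.
  apply/esym; apply: (mulIf nz); apply: (mulfI (x := 4%:R)).
    by rewrite (natrM _ 2 2) mulf_neq0 //; apply: contraTneq fps_two_unit => ->; rewrite unitr0.
  transitivity (fpsD lambda * (1 + kappa) ^+ 3).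
    rewrite vE; transitivity (v * m ^+ 4 * (1 + kappa) * (lambda * (1 + kappa) ^+ 2)).
      by rewrite lambda_kappa; ring.
    by ring.
  rewrite e1 Dk.
  transitivity (4%:R * fpsV v * kappa * (phi ^+ 2 * m ^+ 2 * (1 - kappa))).
    by ring.
  rewrite (_ : phi ^+ 2 * m ^+ 2 * (1 - kappa) = m ^+ 4 * (1 + kappa)); first by ring.
  by rewrite -[4%N]/(2 * 2)%N exprM phi_sqrE phim_sqrE; ring.
by rewrite vE (fpsV_fixed Vv) v0 rmorph1 mul1r.
Qed.

(* Both sides y start with 16 q and satisfy
   y(q)^2 E(q^8)^6 = 16 y(q^2) E(q^4)^12, which determines y. *)
Lemma phi_phim_euler :
  (phi ^+ 4 - m ^+ 4) * fpsV m ^+ 2 = 16%:R * fpsX * E4 ^+ 6.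
Proof.
pose A := phi ^+ 4 - m ^+ 4.
have A2 : A ^+ 2 = 16%:R * fpsV A * P ^+ 4.
  have -> : A = 4%:R * kappa * P ^+ 4.
    by rewrite /A -[4%N]/(2 * 2)%N !exprM phi_sqrE phim_sqrE; ring.
  have -> : fpsV (4%:R * kappa * P ^+ 4) = fpsV A.
    by congr fpsV; rewrite /A -[4%N]/(2 * 2)%N !exprM phi_sqrE phim_sqrE; ring.
  rewrite /A -lambdaE rmorphM /= fpsV_lambda rmorphXn /= -/P; ring.
have [y0 ey c0] : exists2 y0, A * fpsV m ^+ 2 = fpsX * y0 & coef y0 0 = 16%:R.
  have [|y0 ey c0] := @fps_coef0_X _ (A * fpsV m ^+ 2).
    by rewrite coef0_fpsM /A -lambdaE coef0_fpsM coef0_lambda mulr0 mul0r.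
  exists y0 => //; rewrite c0 coef1_fpsM /A -lambdaE (coef0_fpsM (phi ^+ 4)).
  rewrite coef0_lambda mulr0 mul0r add0r (coef1_fpsM (phi ^+ 4)) coef0_lambda.
  rewrite coef1_lambda mulr0 addr0 !coef0_fps_exp coef_V !coef0_theta.
  by rewrite expr0 !expr1n mul1r mulr1.
have PVm : P * fpsV m = fpsV (fpsV m) ^+ 2.
  by rewrite -rmorphM phi_m rmorphXn.
have E48 : fpsV (fpsV m) * fpsV E4 = E4 ^+ 2.
  by rewrite -!rmorphM phim_euler !rmorphXn.
have c16 : 16%:R != 0 :> K by rewrite -[16%N]/(2 ^ 4)%N natrX expf_neq0.
have u16 : (16%:R * E4 ^+ 6 : fps K) \is a GRing.unit.
  apply: fps_unit_coef0; rewrite -(rmorph_nat (@fpsC K)) coef_fpsCM coef0_fps_exp.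
  by rewrite !coef_V coef0_euler expr1n mulr1.
have [G Gy] : exists G, G * (16%:R * E4 ^+ 6) = y0.
  by exists (y0 / (16%:R * E4 ^+ 6)); rewrite divrK.
suff G1 : G = 1 by rewrite ey -Gy G1; ring.
have y2 : y0 ^+ 2 * fpsV E4 ^+ 6 = 16%:R * fpsV y0 * E4 ^+ 12.
  apply: (@fpsXn_inj _ 2).
  transitivity ((A * fpsV m ^+ 2) ^+ 2 * fpsV E4 ^+ 6); first by rewrite ey; ring.
  have Vy : fpsX ^+ 2 * fpsV y0 = fpsV A * fpsV (fpsV m) ^+ 2.
    by rewrite -fpsV_X -rmorphM -ey rmorphM rmorphXn.
  transitivity (A ^+ 2 * fpsV m ^+ 4 * fpsV E4 ^+ 6); first by ring.
  transitivity (16%:R * (fpsX ^+ 2 * fpsV y0) * E4 ^+ 12); last by ring.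
  rewrite A2 Vy.
  transitivity (16%:R * fpsV A * (P * fpsV m) ^+ 4 * fpsV E4 ^+ 6); first by ring.
  rewrite PVm.
  transitivity (16%:R * fpsV A * fpsV (fpsV m) ^+ 2 *
    (fpsV (fpsV m) * fpsV E4) ^+ 6); first by ring.
  by rewrite E48; ring.
apply: (fps_sqr_V two0).
  apply: (mulIf c16); rewrite mul1r -[RHS]c0 -Gy coef0_fpsM.
  rewrite -(rmorph_nat (@fpsC K)) coef_fpsCM coef0_fps_exp.
  by rewrite !coef_V coef0_euler expr1n mulr1.
have VGy : fpsV G * (16%:R * fpsV E4 ^+ 6) = fpsV y0.
  by rewrite -fpsV_natMX -rmorphM Gy.
have E0 : E4 != 0 by apply: (@fps_coef0_neq0 _ _ 0); rewrite !coef_V coef0_euler oner_eq0.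
have s16 : (16%:R : fps K) != 0.
  by apply: (@fps_coef0_neq0 _ _ 0); rewrite -(rmorph_nat (@fpsC K)).
apply: (mulIf (mulf_neq0 (mulf_neq0 s16 s16) (mulf_neq0 (expf_neq0 12 E0)
  (expf_neq0 6 (fpsV_eq0 E0))))).
transitivity (y0 ^+ 2 * fpsV E4 ^+ 6); first by rewrite -Gy; ring.
by rewrite y2 -VGy; ring.
Qed.

(** The right-hand side is 16 f, since phim^3 = E^6 / E(q^2)^3 by [phim_euler]. *)
Lemma f_theta :
  phi ^+ 9 * (lambda * (1 - lambda)) = 16%:R * (fpsX * (m ^+ 3 * E4 ^+ 6)).
Proof.
transitivity (phi * (phi ^+ 4 * lambda) * (phi ^+ 4 - phi ^+ 4 * lambda)).
  by ring.
rewrite lambdaE.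
transitivity ((phi ^+ 4 - m ^+ 4) * (phi * m) * m ^+ 3); first by ring.
by rewrite phi_m phi_phim_euler; ring.
Qed.

Lemma fpsD_lambda_phi : fpsD lambda = lambda * (1 - lambda) * phi ^+ 4.
Proof.
rewrite fpsD_lambda.
have -> : m ^+ 4 = phi ^+ 4 - phi ^+ 4 * lambda by rewrite lambdaE; ring.
by ring.
Qed.
End Theta.

(** * The Landen transformation and Eisenstein independence *)

Section Landen.
Variable A : comNzRingType.

Lemma coef_linear_exp (c : A) n i : ((1 + c *: 'X) ^+ n)`_i = c ^+ i *+ 'C(n, i).
Proof.
rewrite exprDn coef_sum; under eq_bigr => j _ do
  rewrite expr1n mul1r exprZn coefMn coefZ coefXn.
have [ni|ni] := ltnP n i.
  rewrite bin_small // big1 // => j _.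
  by rewrite gtn_eqF ?mulr0 ?mul0rn // (leq_trans (ltn_ord j)).
rewrite (bigD1 (Ordinal (ni : i < n.+1)%N)) //= eqxx mulr1 big1 ?addr0 // => j ji.
rewrite [i == j](_ : _ = false) ?mulr0 ?mul0rn //.
by apply: contraNF ji => /eqP e; apply/eqP/val_inj.
Qed.

(* Both sides are the coefficient of w^m in the m-th power of
   (1 + z)^2 w - z (1 + w)^2 = (w - z) (1 - z w). *)
Lemma landen_binomial (z : A) m :
  \sum_(i < m.+1) ((- z) ^+ i * (1 + z) ^+ (2 * (m - i))) *+ 'C(2 * i, i) *+ 'C(m, i) =
  \sum_(i < m.+1) z ^+ (2 * i) *+ 'C(m, i) *+ 'C(m, i).
Proof.
pose u : {poly A} := ((1 + z) ^+ 2) *: 'X.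
pose v : {poly A} := (- z) *: (1 + 1 *: 'X) ^+ 2.
have uv : u + v = ('X + (- z)%:P) * (1 + (- z) *: 'X).
  by rewrite /u /v -!mul_polyC !polyCN rmorphXn /= polyCD polyC1; ring.
transitivity (((u + v) ^+ m)`_m).
  rewrite exprDn coef_sum; apply: eq_bigr => i _.
  rewrite coefMn /u /v !exprZn -exprM -scalerAl -scalerAr scalerA coefZ -exprM.
  rewrite coefXnM ltnNge leq_subr /= subKn; last by rewrite -ltnS.
  by rewrite coef_linear_exp expr1n mulr_natr [_ ^+ _ * (- z) ^+ _]mulrC.
rewrite uv exprMn [X in X * _]exprDn mulr_suml coef_sum; apply: eq_bigr => i _.
rewrite -rmorphXn mulrnAl coefMn -mulrA coefXnM ltnNge leq_subr /= subKn -1?ltnS //.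
rewrite coefCM coef_linear_exp; congr (_ *+ _).
by rewrite mulrnAr -exprD addnn -mul2n exprM sqrrN -exprM.
Qed.
End Landen.

Section Eisenstein.
Variables (K : fieldType) (S : idomainType) (ev : {rmorphism {poly K} -> S}).
Hypothesis ev_inj : injective ev.
Variables (H : {poly K}) (a : K) (m' : nat) (z : S).
Let m := m'.+1.
Hypotheses (Ha : H.[a] = 0) (H'a : H^`().[a] != 0) (zm : z ^+ m = ev H).

(* The matrix of multiplication by sum_i P_i z^i in the basis 1, z, ...,
   z^(m-1) is singular; evaluated at a it is triangular with diagonal P_0(a),
   because H(a) = 0. *)
Lemma eisenstein_coef0 (P : nat -> {poly K}) :
  \sum_(i < m) ev (P i) * z ^+ i = 0 -> (P 0%N).[a] = 0.
Proof.
move=> P0.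
pose M : 'M[{poly K}]_m := \matrix_(i, j)
  if (i <= j)%N then P (j - i)%N else H * P (m + j - i)%N.
pose V : 'cV[S]_m := \col_j z ^+ j.
have MV : map_mx ev M *m V = 0.
  apply/colP => i; rewrite !mxE.
  have li := ltn_ord i.
  transitivity (z ^+ i * \sum_(k < m) ev (P k) * z ^+ k); last by rewrite P0 mulr0.
  rewrite mulr_sumr [RHS](bigID (fun k : 'I_m => k < m - i)%N) /=.
  rewrite [LHS](bigID (fun j : 'I_m => i <= j)%N) /=; congr (_ + _).
    rewrite (big_ord_narrow (leq_subr i m)) /=.
    pose F j := ev (P (j - i)%N) * z ^+ j.
    transitivity (\sum_(j < m | (i <= j)%N) F j).
      by apply: eq_bigr => j ij; rewrite !mxE ij.
    rewrite -(big_geq_mkord i m xpredT) -{1}[nat_of_ord i]add0n big_addn big_mkord.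
    by apply: eq_bigr => k _; rewrite /F addnK exprD; ring.
  under [in RHS]eq_bigl => k do rewrite -leqNgt.
  pose F k := z ^+ i * (ev (P k) * z ^+ k).
  rewrite -(big_geq_mkord (m - i) m xpredT F) -{1}[(m - i)%N]add0n big_addn subKn 1?ltnW //.
  rewrite big_mkord; under eq_bigl => j do rewrite -ltnNge.
  rewrite (big_ord_narrow (ltnW li)); apply: eq_bigr => j _; rewrite !mxE /= /F.
  have lj := ltn_ord j; rewrite leqNgt lj /= rmorphM -zm.
  have -> : (m + j - i = j + (m - i))%N by lia.
  have {1}-> : m = (i + (m - i))%N by rewrite subnKC // ltnW.
  by rewrite !exprD; ring.
(* The kernel vector has first entry z^0 = 1, so multiplying by the adjugate gives det = 0. *)
have detM : \det M = 0.
  apply: ev_inj; rewrite rmorph0 -det_map_mx.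
  have /(congr1 (mulmx (\adj (map_mx ev M)))) := MV.
  rewrite mulmxA mul_adj_mx mulmx0 mul_scalar_mx => /colP /(_ ord0).
  by rewrite !mxE expr0 mulr1.
have : \det (map_mx (horner_eval a) M) = (P 0%N).[a] ^+ m.
  rewrite -det_tr det_trig; last first.
    apply/is_trig_mxP => i j ij; rewrite !mxE /horner_eval leqNgt ij /=.
    by rewrite hornerM Ha mul0r.
  under eq_bigr => i _ do rewrite !mxE leqnn subnn.
  by rewrite prodr_const card_ord.
rewrite det_map_mx detM rmorph0 => /esym/eqP; rewrite expf_eq0 => /andP[_ /eqP].
by [].
Qed.

(** Induction on i by rotating the relation: P_0 is divisible by p = X - a, so multiply by z^(m-1),
    replace z^m by H = H1 p and divide by p. Then P_(i+1) moves to index i with the factor H1,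
    nonzero at a. *)
Lemma eisenstein_coef (P : nat -> {poly K}) i :
  \sum_(i < m) ev (P i) * z ^+ i = 0 -> (i < m)%N -> (P i).[a] = 0.
Proof.
pose p := 'X - a%:P.
have [H1 HE] : exists H1, H = H1 * p by apply/factor_theorem/rootP.
have H1a : H1.[a] != 0.
  move: H'a; rewrite HE derivM hornerD !hornerM derivXsubC !hornerE subrr.
  by rewrite mulr0 add0r.
have evp : ev p != 0.
  by rewrite -(rmorph0 ev) (inj_eq ev_inj) polyXsubC_eq0.
elim: i P => [|i IH] P rel im; first exact: eisenstein_coef0 rel.
have [P0' eP0] : exists P0', P 0%N = P0' * p.
  by apply/factor_theorem/rootP; apply: eisenstein_coef0.
have := IH (fun j => if j == m' then P0' else H1 * P j.+1) _ (ltnW im).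
rewrite ltn_eqF // hornerM => e; apply: (mulfI H1a); rewrite mulr0; apply: e.
apply: (mulfI evp); rewrite mulr0.
transitivity (z ^+ m' * \sum_(i < m) ev (P i) * z ^+ i); last by rewrite rel mulr0.
rewrite [X in _ = _ * X]big_ord_recl big_ord_recr /= eqxx expr0 eP0 rmorphM !mulrDr addrC.
congr (_ + _); first by ring.
rewrite !mulr_sumr; apply: eq_bigr => j _; rewrite ltn_eqF ?ltn_ord //.
rewrite /bump /= add1n.
have -> : z ^+ m' * (ev (P j.+1) * z ^+ j.+1) = z ^+ m * (ev (P j.+1) * z ^+ j).
  by rewrite !exprS; ring.
by rewrite zm HE !rmorphM; ring.
Qed.

(** All coefficients vanish at a, so the relation can be divided by X - a again and again; a nonzero
    polynomial is not divisible by every power of X - a. *)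
Lemma eisenstein_indep (P : nat -> {poly K}) i :
  \sum_(i < m) ev (P i) * z ^+ i = 0 -> (i < m)%N -> P i = 0.
Proof.
pose p := 'X - a%:P.
have evp : ev p != 0.
  by rewrite -(rmorph0 ev) (inj_eq ev_inj) polyXsubC_eq0.
have dvd n (Q : nat -> {poly K}) j : \sum_(i < m) ev (Q i) * z ^+ i = 0 ->
    (j < m)%N -> exists q, Q j = q * p ^+ n.
  elim: n Q => [|n IH] Q rel jm; first by exists (Q j); rewrite mulr1.
  have Qp k : (k < m)%N -> Q k = Q k %/ p * p.
    move=> km; apply/esym/divpK; rewrite dvdp_XsubCl; apply/rootP.
    exact: eisenstein_coef.
  have [|//|q eq] := IH (fun k => Q k %/ p).
    apply: (mulfI evp); rewrite mulr0; apply: etrans rel.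
    rewrite mulr_sumr; apply: eq_bigr => k _.
    by rewrite {2}[Q k]Qp // rmorphM; ring.
  by exists q; rewrite (Qp j jm) eq exprSr mulrA.
move=> rel im; apply/eqP/negP => /negP P0.
have [q eq] := dvd (size (P i)) P i rel im.
have : p ^+ size (P i) %| P i by rewrite [X in _ %| X]eq dvdp_mulIr.
by move/(dvdp_leq P0); rewrite size_exp_XsubC ltnn.
Qed.
End Eisenstein.

(** * The Hasse polynomial *)

Lemma mul_central_bin i :
  (i.+1 * 'C(2 * i.+1, i.+1) = 2 * (2 * i).+1 * 'C(2 * i, i))%N.
Proof.
have e1 := mul_bin_diag (2 * i).+2 i.
have e2 := mul_bin_diag (2 * i).+1 i.
have e3 : 'C((2 * i).+1, i) = 'C((2 * i).+1, i.+1).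
  by rewrite -[LHS]bin_sub; [congr binomial|]; lia.
have -> : (2 * i.+1 = (2 * i).+2)%N by lia.
rewrite -e1 /= e3; move: e2 => /=; nia.
Qed.

Section Hasse.
Variables (K : fieldType) (m : nat).
Hypothesis charK : (2 * m).+1 \in [pchar K].

Lemma pchar_nat_neq0 n : (0 < n <= 2 * m)%N -> n%:R != 0 :> K.
Proof.
by move=> /andP[n0 nm]; rewrite -(dvdn_pcharf charK) gtnNdvd.
Qed.

Lemma pchar_double : 2%:R * m%:R + 1 = 0 :> K.
Proof. by rewrite -natrM natr1 (pcharf0 charK). Qed.

(* The polynomial 2F1(1/2, 1/2; 1; t) truncated modulo l = 2m + 1: its
   coefficients are 'C(-1/2, i)^2, and -1/2 = m modulo l. *)
Definition hasse : {poly K} := \poly_(i < m.+1) ('C(m, i) ^ 2)%:R.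

Lemma coef_hasse i : hasse`_i = ('C(m, i) ^ 2)%:R.
Proof. by rewrite coef_poly; case: ltnP => // mi; rewrite bin_small. Qed.

(** Over the rationals 'C(2i, i) = (-4)^i 'C(-1/2, i), and -1/2 = m modulo l. *)
Lemma central_bin_pchar i : (i <= m)%N ->
  'C(2 * i, i)%:R = (- 4%:R) ^+ i * 'C(m, i)%:R :> K.
Proof.
elim: i => [|i IH] im; first by rewrite !bin0 mulr1.
have i0 : i.+1%:R != 0 :> K by apply: pchar_nat_neq0; lia.
apply: (mulfI i0); rewrite -natrM mul_central_bin natrM (IH (ltnW im)).
transitivity ((- 4%:R) ^+ i.+1 * (i.+1 * 'C(m, i.+1))%:R : K); last first.
  by rewrite natrM; ring.
rewrite mul_bin_left [((m - i) * _)%:R]natrM natrB ?(ltnW im) //.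
rewrite [(2 * (2 * i).+1)%:R]natrM -[(2 * i).+1%:R]natr1 [(2 * i)%:R]natrM exprS.
apply/subr0_eq; rewrite -[RHS](mulr0 (2%:R * (- 4%:R) ^+ i * 'C(m, i)%:R)).
by rewrite -pchar_double; ring.
Qed.

Lemma hasse_rec i :
  4%:R * i.+1%:R ^+ 2 * hasse`_i.+1 = (2 * i).+1%:R ^+ 2 * hasse`_i.
Proof.
rewrite !coef_hasse.
have -> : 4%:R * i.+1%:R ^+ 2 * ('C(m, i.+1) ^ 2)%:R =
    4%:R * (i.+1 * 'C(m, i.+1))%:R ^+ 2 :> K.
  by rewrite natrX natrM; ring.
rewrite mul_bin_left.
have [im|im] := leqP i m; last by rewrite bin_small // muln0 expr0n !mulr0.
rewrite [((m - i) * _)%:R]natrM natrB // natrX -[(2 * i).+1%:R]natr1 [(2 * i)%:R]natrM.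
apply/subr0_eq; rewrite -[RHS](mulr0 ((2%:R * m%:R - 4%:R * i%:R - 1) *
  'C(m, i)%:R ^+ 2)).
by rewrite -pchar_double; ring.
Qed.

Lemma deriv_natr k : (k%:R : {poly K})^`() = 0.
Proof. by rewrite -(rmorph_nat (@polyC K)) derivC. Qed.

(** The n-th derivative of the hypergeometric equation of [hasse]; the case n = 0 is [hasse_rec]
    read coefficientwise. *)
Lemma hasse_ode n :
  4%:R * ('X * (1 - 'X)) * hasse^`(n.+2)
  + (4 * n.+1)%:R * ((1 - 2%:R * 'X) * hasse^`(n.+1))
  - ((2 * n).+1 ^ 2)%:R * hasse^`(n) = 0.
Proof.
elim: n => [|n IH]; last first.
  have := congr1 (@deriv K) IH.
  rewrite deriv0 derivB derivD !derivM !derivB !derivM derivX !deriv_natr.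
  rewrite -[(1 : {poly K})]/(1%:R) deriv_natr -!derivnS => e.
  rewrite -e; ring.
have -> : 4%:R * ('X * (1 - 'X)) * hasse^`(2)
    + (4 * 1)%:R * ((1 - 2%:R * 'X) * hasse^`(1))
    - ((2 * 0).+1 ^ 2)%:R * hasse^`(0)
  = ('X * hasse^`(2) - 'X * ('X * hasse^`(2)) + hasse^`(1) - ('X * hasse^`(1)) *+ 2)
    *+ 4 - hasse by rewrite derivn0; ring.
apply/polyP => i; rewrite coefB coefMn !(coefB, coefD) !coefXM !coef_derivn coef0.
have := hasse_rec i => /eq_subr0 e; rewrite -[RHS]e.
case: i {e} => [|[|i]] /=; rewrite !ffactnS !ffactn0 !muln1 !addSn !add0n /=; ring.
Qed.

Lemma natr_fact_neq0 k : (k <= 2 * m)%N -> k`!%:R != 0 :> K.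
Proof.
elim: k => [|k IH] km; first by rewrite oner_eq0.
by rewrite factS natrM mulf_neq0 ?IH ?(ltnW km) ?pchar_nat_neq0.
Qed.

(** Source of the contradiction in both root lemmas below: [hasse] is monic of degree m, so its m-th
    derivative is the constant m!, nonzero as m < l. *)
Lemma derivn_hasse_neq0 a : (hasse^`(m)).[a] != 0.
Proof.
have -> : hasse^`(m) = (m`!%:R)%:P.
  apply/polyP => -[|i]; rewrite coef_derivn coef_hasse coefC /= ?addn0.
    by rewrite binn ffactnn.
  by rewrite bin_small ?mul0rn //; lia.
by rewrite hornerC natr_fact_neq0 // leq_pmull.
Qed.

Lemma hasse_ode_eval n a :
  4%:R * (a * (1 - a)) * hasse^`(n.+2).[a]
  + (4 * n.+1)%:R * ((1 - 2%:R * a) * hasse^`(n.+1).[a])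
  = ((2 * n).+1 ^ 2)%:R * hasse^`(n).[a].
Proof.
apply/subr0_eq.
have /(congr1 (horner^~ a)) := hasse_ode n; rewrite horner0 => <-.
have eC (k : nat) (p : {poly K}) : (k%:R * p).[a] = k%:R * p.[a].
  by rewrite mulr_natl hornerMn mulr_natl.
have e1 : (1 - 'X : {poly K}).[a] = 1 - a by rewrite !hornerE.
have e2 : (1 - 2%:R * 'X : {poly K}).[a] = 1 - 2%:R * a.
  by rewrite hornerD hornerN eC hornerX hornerC.
by rewrite hornerD hornerN hornerD -!mulrA !eC !hornerM hornerX e1 e2.
Qed.

Lemma pchar4_neq0 : (0 < m)%N -> 4%:R != 0 :> K.
Proof. by move=> m0; rewrite (natrM _ 2 2) mulf_neq0 // pchar_nat_neq0 //; lia. Qed.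

(** The constant term excludes 0. At 1 the leading term of [hasse_ode] disappears, so a zero there
    would propagate from each derivative to the next, up to order m. *)
Lemma hasse_root a : (0 < m)%N -> hasse.[a] = 0 -> a * (1 - a) != 0.
Proof.
move=> m0 Ha; rewrite mulf_neq0 //.
  apply: contra_eq_neq Ha => ->.
  by rewrite horner_coef0 coef_hasse bin0 oner_eq0.
(* The trivial equation reduces the goal to deriving the absurdity [0 != 0] from 1 = a. *)
rewrite subr_eq0; apply: contra_eq_neq (erefl 0 : 0 = 0 :> K) => a1.
suff H n : (n <= m)%N -> (hasse^`(n)).[a] = 0.
  by have := derivn_hasse_neq0 a; rewrite H ?eqxx.
elim: n => // n IH nm; have := hasse_ode_eval n a.
rewrite IH ?(ltnW nm) // -a1 subrr !mulr0 mul0r add0r => /eqP.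
rewrite natrM !mulf_eq0 (negbTE (pchar4_neq0 m0)).
rewrite (negbTE (pchar_nat_neq0 _)) ?mulr1 /=; last by lia.
rewrite [_ - _](_ : _ = -1); last by ring.
by rewrite oppr_eq0 oner_eq0 => /eqP.
Qed.

(** As a (1 - a) is nonzero, [hasse_ode] would make all derivatives vanish at a double root. *)
Lemma hasse_simple_root a : (0 < m)%N -> hasse.[a] = 0 -> (hasse^`()).[a] != 0.
Proof.
move=> m0 Ha; have a01 := hasse_root m0 Ha.
apply/negP => /eqP H'a.
suff H n : (hasse^`(n)).[a] = 0 /\ (hasse^`(n.+1)).[a] = 0.
  by have := derivn_hasse_neq0 a; rewrite (H m).1 eqxx.
elim: n => // n [IH1 IH2]; split=> //; have := hasse_ode_eval n a.
rewrite IH1 IH2 !mulr0 addr0 => /eqP.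
by rewrite mulf_eq0 mulf_eq0 (negbTE (pchar4_neq0 m0)) (negbTE a01) => /eqP.
Qed.

End Hasse.

(** * Substitution of a power series into polynomials *)

Section Subst.
Variables (K : fieldType) (x : fps K).

Definition fps_subst : {rmorphism {poly K} -> fps K} :=
  GRing.RMorphism.clone _ _ (horner_eval x \o map_poly (@fpsC K)) _.

Lemma fps_substX : fps_subst 'X = x.
Proof. by rewrite /fps_subst /= /horner_eval map_polyX hornerX. Qed.

Lemma fps_substC c : fps_subst c%:P = fpsC c.
Proof. by rewrite /fps_subst /= /horner_eval map_polyC hornerC. Qed.

Lemma fps_subst_poly n (c : nat -> K) :
  fps_subst (\poly_(i < n) c i) = \sum_(i < n) fpsC (c i) * x ^+ i.
Proof.
rewrite poly_def rmorph_sum; apply: eq_bigr => i _.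
by rewrite -mul_polyC rmorphM rmorphXn fps_substX fps_substC.
Qed.

Lemma fpsD_subst p : fpsD (fps_subst p) = fps_subst p^`() * fpsD x.
Proof.
elim/poly_ind: p => [|p c IH].
  by rewrite deriv0 rmorph0 mul0r -[0]/(0%:R) fpsD_nat.
rewrite !rmorphD !rmorphM fpsD_add fps_substX fps_substC fpsD_mul IH.
rewrite derivD derivM derivX derivC addr0 mulr1 fpsD_const rmorphD rmorphM.
by rewrite fps_substX; ring.
Qed.

Lemma fps_subst_inj : coef x 0 = 0 -> x != 0 -> injective fps_subst.
Proof.
move=> x0 xn; suff inj0 p : fps_subst p = 0 -> p = 0.
  move=> p q /eqP; rewrite -subr_eq0 -rmorphB => /eqP/inj0/eqP.
  by rewrite subr_eq0 => /eqP.
elim/poly_ind: p => [//|p c IH]; rewrite rmorphD rmorphM fps_substX fps_substC => e.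
have c0 : c = 0.
  have /fpsP/(_ 0%N) := e; rewrite coef_fpsD coef0_fpsM x0 mulr0 add0r.
  by [].
move/eqP: e; rewrite c0 rmorph0 addr0 mulf_eq0 (negbTE xn) orbF => /eqP/IH ->.
by rewrite mul0r addr0.
Qed.
End Subst.

Section Theta.
Variables (K : fieldType) (m : nat).
Hypothesis charK : (2 * m).+1 \in [pchar K].
Hypothesis m_gt0 : (0 < m)%N.

Lemma pchar_two_neq0 : 2%:R != 0 :> K.
Proof. by apply: (pchar_nat_neq0 charK); lia. Qed.
Let two0 := pchar_two_neq0.

Let ev := fps_subst (lambda K).
Let H := hasse K m.

Lemma subst_lambda_inj : injective ev.
Proof. exact: fps_subst_inj (coef0_lambda K) (lambda_neq0 two0). Qed.

Lemma subst_lambda_hasse : ev H = \sum_(i < m.+1) lambda K ^+ i *+ 'C(m, i) *+ 'C(m, i).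
Proof.
rewrite /ev /H fps_subst_poly; apply: eq_bigr => i _.
by rewrite rmorph_nat mulr_natl -mulrnA mulnn.
Qed.

(** The left-hand side is fixed by V, hence constant. As V sends lambda to kappa^2, this amounts to
    [landen_binomial] at z = kappa, combined with [central_bin_pchar] and [lambda_kappa]. *)
Lemma phi_hasse : (phi K ^+ 4) ^+ m * ev H = 1.
Proof.
set y := _ * _.
pose P := fpsV (phi K).
have y0 : coef y 0 = 1.
  rewrite /y coef0_fpsM !coef0_fps_exp coef0_theta !expr1n mul1r subst_lambda_hasse.
  rewrite coef_fps_sum big_ord_recl bin0 !mulr1n coef_fps1 big1 ?addr0 // => i _.
  by rewrite !coef_fpsMn coef0_fps_exp coef0_lambda // expr0n !mul0rn.
suff /fpsV_fixed -> : fpsV y = y by rewrite y0 rmorph1.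
rewrite /y rmorphM !rmorphXn subst_lambda_hasse rmorph_sum /= -/P.
have -> : (phi K ^+ 4) ^+ m = (P ^+ 4) ^+ m * (1 + kappa K) ^+ (2 * m).
  have -> : phi K ^+ 4 = P ^+ 4 * (1 + kappa K) ^+ 2.
    by rewrite -[4%N]/(2 * 2)%N exprM (phi_sqrE two0) -/P; ring.
  by rewrite exprMn -!exprM.
rewrite -mulrA; congr (_ * _).
have eV i : fpsV (lambda K ^+ i *+ 'C(m, i) *+ 'C(m, i)) =
    kappa K ^+ (2 * i) *+ 'C(m, i) *+ 'C(m, i).
  by rewrite !rmorphMn rmorphXn /= fpsV_lambda // exprM.
under eq_bigr => i _ do rewrite eV.
rewrite -landen_binomial mulr_sumr; apply: eq_bigr => i _; apply: esym.
rewrite mulrnAr; congr (_ *+ _).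
have im : (i <= m)%N by rewrite -ltnS.
rewrite -[RHS]mulr_natl -(rmorph_nat (@fpsC K)) (central_bin_pchar charK im).
have -> : (2 * m = 2 * (m - i) + 2 * i)%N by rewrite -mulnDr subnK.
rewrite rmorphM rmorphXn rmorphN !rmorph_nat exprD.
transitivity ((1 + kappa K) ^+ (2 * (m - i)) *
  (lambda K * (1 + kappa K) ^+ 2) ^+ i *+ 'C(m, i)).
  by rewrite exprMn -exprM; ring.
rewrite (lambda_kappa two0).
have -> : (- 4%:R) ^+ i * 'C(m, i)%:R * ((- kappa K) ^+ i * (1 + kappa K) ^+ (2 * (m - i)))
  = ((- 4%:R) * (- kappa K)) ^+ i * (1 + kappa K) ^+ (2 * (m - i)) *+ 'C(m, i).
  by rewrite exprMn; ring.
by rewrite mulrNN; congr (_ *+ _); rewrite mulrC.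
Qed.
End Theta.

(** * Iterated derivatives *)

Section Iterates.
Variables (K : fieldType) (m : nat).
Hypothesis charK : (2 * m).+1 \in [pchar K].
Hypothesis m_gt0 : (0 < m)%N.
Let two0 := pchar_two_neq0 charK m_gt0.
Let ev := fps_subst (lambda K).
Let H := hasse K m.
Let T : {poly K} := 'X * (1 - 'X).
Let y := phi K ^+ 2.

Lemma phi_sqr_neq0 : y != 0.
Proof. exact: expf_neq0 (phi_neq0 K). Qed.

Lemma fpsD_lambda_ev : fpsD (lambda K) = ev T * y ^+ 2.
Proof.
rewrite fpsD_lambda_phi // /y -exprM /ev /T rmorphM rmorphB rmorph1.
by rewrite fps_substX.
Qed.

Lemma phi_sqr_hasse : y ^+ (2 * m) * ev H = 1.
Proof. by rewrite -(phi_hasse charK m_gt0) /y -!exprM mulnA. Qed.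

(** Differentiate [phi_sqr_hasse] and use 2m = -1 modulo l. *)
Lemma fpsD_phi_sqr : fpsD y * ev H = y ^+ 3 * ev (T * H^`()).
Proof.
have /(congr1 fpsD) := phi_sqr_hasse.
rewrite fpsD_mul fpsD_exp -[1]/(1%:R) fpsD_nat fpsD_subst fpsD_lambda_ev.
have -> : (2 * m)%:R = - 1 :> fps K.
  apply: subr0_eq; rewrite opprK natr1 -(rmorph_nat (@fpsC K)).
  by rewrite (pcharf0 charK) rmorph0.
move=> e; apply: (mulfI (expf_neq0 (2 * m).-1 phi_sqr_neq0)).
rewrite rmorphM; apply/esym/subr0_eq; rewrite -e.
have -> : y ^+ (2 * m) = y ^+ (2 * m).-1 * y by rewrite -exprSr prednK //; lia.
by rewrite -/ev; ring.
Qed.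

Lemma fpsD_phi_sqr_exp k : fpsD (y ^+ k) * ev H = k%:R * y ^+ k * y ^+ 2 * ev (T * H^`()).
Proof.
rewrite fpsD_exp; case: k => [|k]; first by rewrite !mul0r.
by rewrite -pred_Sn -mulrA fpsD_phi_sqr [y ^+ k.+1]exprS; ring.
Qed.

(** The polynomials Q_i. The factor 9m + i is 9m + 2i, from differentiating the power of y, less i,
    from differentiating H^(-i). *)
Fixpoint iter_num i : {poly K} :=
  if i is i'.+1 then
    T * (H * (iter_num i')^`() + (9 * m + i')%:R * (H^`() * iter_num i'))
  else T ^+ (2 * m).

(** This is g = (16 f)^(l-1), by [f_theta]. *)
Definition f_power : fps K := y ^+ (9 * m) * ev (T ^+ (2 * m)).

Lemma iter_fpsD i :
  iter i fpsD f_power * ev H ^+ i = y ^+ (9 * m + 2 * i) * ev (iter_num i).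
Proof.
elim: i => [|i IH]; first by rewrite muln0 addn0 expr0 mulr1.
have /(congr1 fpsD) := IH.
rewrite fpsD_mul fpsD_mul (fpsD_exp (ev H)) (fpsD_subst _ H).
rewrite (fpsD_subst _ (iter_num i)) => e.
rewrite iterS.
transitivity ((fpsD (iter i fpsD f_power) * ev H ^+ i) * ev H).
  by rewrite exprSr; ring.
have -> : fpsD (iter i fpsD f_power) * ev H ^+ i =
  fpsD (y ^+ (9 * m + 2 * i)) * ev (iter_num i) +
  y ^+ (9 * m + 2 * i) * (ev (iter_num i)^`() * fpsD (lambda K)) -
  iter i fpsD f_power * (i%:R * ev H ^+ i.-1 * (ev H^`() * fpsD (lambda K))).
  by rewrite -e -/ev -/H; ring.
transitivity ((fpsD (y ^+ (9 * m + 2 * i)) * ev H) * ev (iter_num i) +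
  y ^+ (9 * m + 2 * i) * (ev (iter_num i)^`() * fpsD (lambda K)) * ev H -
  i%:R * (iter i fpsD f_power * ev H ^+ i) * (ev H^`() * fpsD (lambda K))).
  case: i {IH e} => [|i]; first by ring.
  by rewrite -pred_Sn exprS; ring.
have evS : ev (iter_num i.+1) = ev T * (ev H * ev (iter_num i)^`() +
    (9 * m + i)%:R * (ev H^`() * ev (iter_num i))).
  by rewrite (rmorphM ev T) (rmorphD ev) (rmorphM ev H) (rmorphM ev _%:R)
      (rmorphM ev H^`()) rmorph_nat.
rewrite fpsD_phi_sqr_exp IH fpsD_lambda_ev evS (rmorphM ev T).
have -> : (9 * m + 2 * i.+1 = 9 * m + 2 * i + 2)%N by lia.
by rewrite [y ^+ (_ + _ + 2)]exprD !(natrD _ (9 * m)) (natrM _ 2 i); ring.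
Qed.

(** At a root of H the recursion loses its first summand, and the factors T, 9m + j and H' of the
    other one are nonzero there. *)
Lemma iter_num_root a i : H.[a] = 0 ->
  (forall j, (j < i)%N -> (9 * m + j)%:R != 0 :> K) -> (iter_num i).[a] != 0.
Proof.
move=> Ha; have Ta := hasse_root charK m_gt0 Ha.
have TaE : T.[a] = a * (1 - a) by rewrite hornerM hornerD hornerN !hornerE.
elim: i => [|i IH] nz; first by rewrite horner_exp expf_neq0 // TaE.
rewrite [iter_num _]/= hornerM TaE hornerD (hornerM H) Ha mul0r add0r mulf_neq0 //.
rewrite mulr_natl hornerMn hornerM -mulr_natl mulf_neq0 ?nz //.
rewrite mulf_neq0 ?(hasse_simple_root charK m_gt0 Ha) //.
by apply: IH => j ji; apply: nz; apply: ltnW.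
Qed.

Lemma phi4_inv : exists2 z, z * y ^+ 2 = 1 & z ^+ m = ev H.
Proof.
exists (ev H * (y ^+ 2) ^+ m.-1); have ym := phi_sqr_hasse.
  rewrite -mulrA -exprSr prednK // -exprM mulrC //.
set z := ev H * _.
have zy : z * y ^+ 2 = 1.
  by rewrite -mulrA -exprSr prednK // -exprM mulrC.
apply: (mulfI (expf_neq0 (2 * m) phi_sqr_neq0)); rewrite ym exprM -exprMn.
by rewrite [y ^+ 2 * z]mulrC zy expr1n.
Qed.

(* The coefficient of the sum at q^n is that of f_power times
   n (n^(2m-1) + n^(2m-2) b + ... + b^(2m-1)), a factor which, for b nonzero in
   the prime field, vanishes unless n = b. *)
Lemma no_vanishing_class a (b : K) : H.[a] = 0 -> b != 0 ->
    (forall j, (j <= m)%N -> (9 * m + j)%:R != 0 :> K) ->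
  \sum_(j < 2 * m) fpsC (b ^+ j) * iter (2 * m - j) fpsD f_power <> 0.
Proof.
move=> Ha b0 nz rel; have [z zy zm] := phi4_inv.
pose Q j := iter_num (2 * m - j).
have rel2 : \sum_(j < 2 * m) fpsC (b ^+ j) * z ^+ j * ev (H ^+ j * Q j) = 0.
  apply: (mulfI (expf_neq0 (9 * m) phi_sqr_neq0)); rewrite mulr0.
  transitivity (z ^+ (2 * m) * ev H ^+ (2 * m) *
    \sum_(j < 2 * m) fpsC (b ^+ j) * iter (2 * m - j) fpsD f_power).
    rewrite !mulr_sumr; apply: eq_bigr => j _.
    have eX (x : fps K) : x ^+ (2 * m) = x ^+ (2 * m - j) * x ^+ j.
      by rewrite -exprD subnK // ltnW.
    have := iter_fpsD (2 * m - j).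
    rewrite -/(Q j); move: (iter _ _ _) => g gE.
    rewrite !eX (rmorphM ev (H ^+ j)) (rmorphXn ev j H).
    transitivity (fpsC (b ^+ j) * z ^+ j * z ^+ (2 * m - j) * ev H ^+ j *
      (g * ev H ^+ (2 * m - j))); last by ring.
    rewrite gE exprD [y ^+ (2 * _)]exprM.
    transitivity (fpsC (b ^+ j) * z ^+ j * ev H ^+ j * y ^+ (9 * m) * ev (Q j) *
      (z * y ^+ 2) ^+ (2 * m - j)); first by rewrite zy expr1n; ring.
    rewrite [(z * _) ^+ _]exprMn.
    by move: (z ^+ (2 * m - j)) (y ^+ 2 ^+ (2 * m - j)) => zk yk; ring.
  by rewrite rel mulr0.
(* Since z^(m+j) = H z^j, the terms with index at least m fold onto those below m. *)
pose P j := (b ^+ j)%:P * (H ^+ j * Q j) +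
  (b ^+ (m + j))%:P * (H ^+ (m + j).+1 * Q (m + j)%N).
have relP : \sum_(j < m.-1.+1) ev (P j) * z ^+ j = 0.
  rewrite prednK //; apply: etrans rel2.
  have -> : \sum_(j < 2 * m) fpsC (b ^+ j) * z ^+ j * ev (H ^+ j * Q j) =
    \sum_(j < m + m) fpsC (b ^+ j) * z ^+ j * ev (H ^+ j * Q j).
    by rewrite mul2n addnn.
  rewrite [RHS]big_split_ord -[RHS]big_split; apply: eq_bigr => j _.
  rewrite (_ : nat_of_ord (rshift m j) = (m + j)%N) // (_ : nat_of_ord (lshift m j) = j) //.
  rewrite (rmorphD ev) (rmorphM ev (b ^+ j)%:P) (rmorphM ev (b ^+ (m + j))%:P).
  rewrite !fps_substC (exprD z m) zm [H ^+ (m + j).+1]exprS -mulrA (rmorphM ev H).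
  transitivity (fpsC (b ^+ j) * z ^+ j * ev (H ^+ j * Q j) +
    fpsC (b ^+ (m + j)) * (ev H * z ^+ j) * ev (H ^+ (m + j) * Q (m + j)%N)) => //.
  by move: (ev (_ * _)) (ev (H ^+ (m + j) * _)) (fpsC _) (z ^+ j) => A1 A2 A3 A4; ring.
have [H'a] := hasse_simple_root charK m_gt0 Ha.
have zm' : z ^+ m.-1.+1 = ev H by rewrite prednK.
(* The coefficient of z^(m-1) combines the derivatives of orders m + 1 and 1; once H^(m-1) is
   cancelled, the latter keeps a factor H^(m+1), which vanishes at a. *)
have := eisenstein_indep (@subst_lambda_inj _ _ charK m_gt0) Ha H'a zm' relP (ltnSn m.-1).
rewrite /P.
have -> : (m + m.-1).+1 = (m.-1 + m.+1)%N by lia.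
rewrite (exprD H) => e.
have /eqP : H ^+ m.-1 * ((b ^+ m.-1)%:P * Q m.-1 +
   (b ^+ (m + m.-1))%:P * (H ^+ m.+1 * Q (m + m.-1)%N)) = 0.
  by rewrite -[RHS]e; move: (H ^+ m.-1) (H ^+ m.+1) => A1 A2; ring.
have Hn0 : H != 0.
  by apply: contraNneq H'a => H0; rewrite -/H H0 deriv0 horner0.
rewrite mulf_eq0 (negbTE (expf_neq0 _ Hn0)) /= => /eqP/(congr1 (horner^~ a)).
rewrite hornerD !hornerM horner_exp Ha expr0n mul0r mulr0 addr0 hornerC horner0.
move/eqP; rewrite mulf_eq0 (negbTE (expf_neq0 _ b0)) /=.
apply/negP; rewrite /Q; have -> : (2 * m - m.-1 = m.+1)%N by lia.
by apply: iter_num_root Ha _.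
Qed.
End Iterates.

(** * Classes of vanishing modulo a prime *)

(** This is f / q, by [phim_euler]. *)
Definition f_series (R : comNzRingType) : fps R :=
  phim R ^+ 3 * fpsV (fpsV (@euler R)) ^+ 6.

Section Classes.
Variable K : fieldType.

Lemma coef_D_natr (x : fps K) n : coef (fpsD x) n = coef x n * n%:R.
Proof. by rewrite coef_D mulr_natr. Qed.

(** A series with zero derivative lives on exponents that are 0 in [K], so multiplication by it does
    not mix residue classes. *)
Lemma coef_fpsM_class (x y : fps K) (b : K) : fpsD y = 0 ->
    (forall n, n%:R = b -> coef x n = 0) ->
  forall n, n%:R = b -> coef (x * y) n = 0.
Proof.
move=> Dy xb n nb; rewrite coef_fpsM big1 // => i _.
have ni : (i <= n)%N by rewrite -ltnS.
have [->|y0] := eqVneq (coef y (n - i)) 0; first by rewrite mulr0.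
rewrite xb ?mul0r // -nb; apply/esym/eqP; rewrite -subr_eq0 -natrB //.
have /fpsP/(_ (n - i)%N) := Dy; rewrite coef_D_natr => /eqP.
by rewrite mulf_eq0 (negbTE y0).
Qed.

Lemma fpsD_inv (x y : fps K) : x * y = 1 -> fpsD y = 0 -> fpsD x = 0.
Proof.
move=> xy Dy; have /(congr1 fpsD) := xy.
rewrite fpsD_mul Dy mulr0 addr0 (fpsD_nat K 1) => /(congr1 (fun z => z * x)).
by rewrite mul0r -mulrA [y * x]mulrC xy mulr1.
Qed.

Lemma fpsD0_coef (x : fps K) n : fpsD x = 0 -> n%:R != 0 :> K -> coef x n = 0.
Proof.
move=> /fpsP/(_ n); rewrite coef_D_natr => /eqP.
by rewrite mulf_eq0 orbC => /orP[/eqP ->|/eqP //]; rewrite eqxx.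
Qed.

Variable C : fps K.
Hypothesis Cf : C * f_series K = 1.

(** D V = 2 V D vanishes modulo 2, and [phim] is constant since its other coefficients are doubled.
    Hence [f_series] and its inverse have zero derivative. *)
Lemma coef_char2 k : 2 \in [pchar K] -> odd k -> coef C k = 0.
Proof.
move=> ch ok; have two0 : 2%:R = 0 :> K := pcharf0 ch.
apply: fpsD0_coef; last first.
  by rewrite -(dvdn_pcharf ch) dvdn2 ok.
apply: fpsD_inv Cf _; rewrite /f_series fpsD_mul !fpsD_exp.
have -> : fpsD (fpsV (fpsV (@euler K))) = 0.
  by rewrite fpsD_V -(rmorph_nat (@fpsC K)) two0 rmorph0 mul0r.
suff -> : fpsD (phim K) = 0 by rewrite !mulr0 mul0r addr0.
apply/fpsP => -[|n]; rewrite coef_D // /phim /theta /coef /= big1 ?mul0rn //.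
move=> j _; case: j => -[|j] hj //=.
by rewrite -[_ *+ 2]mulr_natl two0 mul0r mul0rn.
Qed.

(** [f_series] is a cube, so modulo 3 it and its inverse have zero derivative. *)
Lemma coef_char3 k : 3 \in [pchar K] -> ~~ (3 %| k)%N -> coef C k = 0.
Proof.
move=> ch ok; have three0 : 3%:R = 0 :> fps K.
  by rewrite -(rmorph_nat (@fpsC K)) (pcharf0 ch) rmorph0.
apply: fpsD0_coef; last by rewrite -(dvdn_pcharf ch).
apply: fpsD_inv Cf _; rewrite /f_series fpsD_mul !fpsD_exp.
by rewrite (natrM _ 2 3) three0; ring.
Qed.

Section Odd.
Variable m : nat.
Hypothesis charK : (2 * m).+1 \in [pchar K].
Hypothesis m_gt0 : (0 < m)%N.
Let two0 := pchar_two_neq0 charK m_gt0.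

Lemma f_powerE :
  f_power K m = fpsC (16%:R ^+ (2 * m)) * (fpsX ^+ (2 * m) * f_series K ^+ (2 * m)).
Proof.
rewrite rmorphXn rmorph_nat -exprMn -exprMn -/(f_series K).
rewrite -[X in _ = X ^+ _](f_theta two0) exprMn -exprM /f_power -exprM.
rewrite rmorphXn rmorphM rmorphB rmorph1 fps_substX.
by congr (_ ^+ _ * _); lia.
Qed.

Lemma fpsD_pchar (x : fps K) : fpsD (x ^+ (2 * m).+1) = 0.
Proof.
rewrite fpsD_exp -(rmorph_nat (@fpsC K)) (pcharf0 charK) rmorph0.
by rewrite !mul0r.
Qed.

Lemma sixteen_neq0 : 16%:R != 0 :> K.
Proof. by rewrite -[16%N]/(2 ^ 4)%N natrX expf_neq0 //; apply: two0. Qed.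

Lemma natr_pred_pchar : (2 * m)%:R = - 1 :> K.
Proof. by apply/subr0_eq; rewrite opprK natr1 (pcharf0 charK). Qed.

(** [C] and [f_series ^+ (2 * m)] differ by l-th powers, so [coef_fpsM_class] applies in both
    directions. The shift by 1 comes from the factor q^(l-1) of [f_power]. *)
Lemma f_power_class (b : K) :
  (forall n, n%:R = b + 1 -> coef C n = 0) <->
  (forall n, n%:R = b -> coef (f_power K m) n = 0).
Proof.
have fC : f_series K ^+ (2 * m) = C * f_series K ^+ (2 * m).+1.
  by rewrite exprS mulrA Cf mul1r.
have Cf' : C = f_series K ^+ (2 * m) * C ^+ (2 * m).+1.
  by rewrite exprSr mulrA -exprMn mulrC [_ * C]mulrC Cf expr1n mulr1.
split=> [Cb n nb|gb n nb].
  rewrite f_powerE coef_fpsCM coef_fpsXnM; case: ltnP => mn; first by rewrite mulr0.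
  rewrite fC (coef_fpsM_class (fpsD_pchar _) Cb) ?mulr0 //.
  by rewrite natrB // natr_pred_pchar nb opprK.
rewrite Cf' (coef_fpsM_class (fpsD_pchar _) _ nb) // => k kb.
have := gb (k + 2 * m)%N; rewrite natrD natr_pred_pchar kb addrK => /(_ erefl) /eqP.
rewrite f_powerE coef_fpsCM coef_fpsXnM ltnNge leq_addl /= addnK.
by rewrite mulf_eq0 expf_eq0 (negbTE sixteen_neq0) andbF => /eqP.
Qed.

Lemma pchar_fermat n : n%:R ^+ (2 * m).+1 = n%:R :> K.
Proof. by rewrite -(pFrobenius_autE charK) pFrobenius_aut_nat. Qed.

Lemma coef_pchar_large a (b : nat) : (5 <= m)%N -> (hasse K m).[a] = 0 ->
  b%:R != 0 :> K -> ~ (forall n, n%:R = b%:R + 1 :> K -> coef C n = 0).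
Proof.
move=> m5 Ha b0 /f_power_class gb.
apply: (no_vanishing_class charK m_gt0 Ha b0).
  (* 2 (9m + j) = 2j - 9 modulo l, an odd number of absolute value below l. *)
  move=> j jm; apply/eqP => nz.
  have e : (2 * j)%:R = 9%:R :> K.
    apply/subr0_eq; transitivity (2%:R * (9 * m + j)%:R : K).
      rewrite (natrM _ 2 j) (natrD _ (9 * m)) (natrM _ 9 m).
      by apply/subr0_eq; rewrite -[RHS](mulr0 (- 9%:R)) -(pchar_double charK); ring.
    by rewrite nz mulr0.
  case: (leqP (2 * j) 9) => j9.
    have /negP[] := @pchar_nat_neq0 _ _ charK (9 - 2 * j)%N ltac:(lia).
    by rewrite natrB // e subrr.
  have /negP[] := @pchar_nat_neq0 _ _ charK (2 * j - 9)%N ltac:(lia).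
  by rewrite natrB ?(ltnW j9) // e subrr.
have fermat k : k%:R != 0 :> K -> k%:R ^+ (2 * m) = 1 :> K.
  by move=> k0; apply: (mulfI k0); rewrite -exprS pchar_fermat mulr1.
apply/fpsP => n; rewrite coef_fps_sum coef_fps0.
under eq_bigr => j _ do rewrite coef_fpsCM coef_fpsD_iter mulrA.
(* At n = b the coefficient of [f_power] is zero; elsewhere n - b times the geometric sum is n
   (n^(l-1) - b^(l-1)), zero by Fermat. *)
rewrite -mulr_suml; have [/gb ->|nb] := eqVneq (n%:R : K) b%:R; first by rewrite mulr0.
apply/eqP; rewrite mulf_eq0; apply/orP; left; apply/eqP.
have nb0 : n%:R - b%:R != 0 :> K by rewrite subr_eq0.
apply: (mulfI nb0); rewrite mulr0.
transitivity (n%:R * (n%:R ^+ (2 * m) - b%:R ^+ (2 * m)) : K); last first.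
  by rewrite mulrBr -exprS pchar_fermat fermat // mulr1 subrr.
rewrite subrXX mulrCA; congr (_ * _); rewrite mulr_sumr; apply: eq_bigr => j _.
have -> : (2 * m - j = (2 * m - j.+1).+1)%N by have := ltn_ord j; lia.
by rewrite -subn1 -subnDA add1n exprS; ring.
Qed.

End Odd.

(** Lets [ring] check an identity modulo 5: the witness [z] records the multiple of 5 that is
    dropped. *)
Lemma poly_eq_char5 (p q z : {poly K}) : 5 \in [pchar K] ->
  p = q + 5%:R * z -> p = q.
Proof.
move=> ch ->.
by rewrite -[X in X * z](rmorph_nat (@polyC K)) (pcharf0 ch) rmorph0 mul0r addr0.
Qed.

(** Yields D^3 g = D g modulo 5. As H = 1 - T modulo 5, the computation stays within polynomials in
    T and its derivative U, with U^2 = 1 - 4 T. *)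
Lemma iter_num_char5 : 5 \in [pchar K] ->
  iter_num K 2 3 = hasse K 2 ^+ 3 * iter_num K 2 1.
Proof.
move=> ch; pose T : {poly K} := 'X * (1 - 'X); pose U : {poly K} := 1 - 2%:R * 'X.
have d1 : (1 : {poly K})^`() = 0 := deriv_natr K 1.
have dT : T^`() = U by rewrite derivM derivB derivX d1 /U; ring.
have dU : U^`() = - 2%:R by rewrite derivB derivM derivX deriv_natr d1; ring.
have UU : U ^+ 2 = 1 - 4%:R * T by rewrite /U /T; ring.
have HE : hasse K 2 = 1 - T.
  apply: (poly_eq_char5 (z := 'X)) => //.
  transitivity (1 + 4%:R * 'X + 'X ^+ 2 : {poly K}); last by rewrite /T; ring.
  apply/polyP => i; rewrite coef_hasse !coefD mulr_natl coefMn coefX coefXn coef1.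
  by case: i => [|[|[|i]]] /=; rewrite ?bin0 ?bin1 ?binn ?bin_small //=; ring.
have dH : (hasse K 2)^`() = - U by rewrite HE derivB d1 dT sub0r.
have step i : iter_num K 2 i.+1 =
    T * ((1 - T) * (iter_num K 2 i)^`() - (18 + i)%:R * (U * iter_num K 2 i)).
  by rewrite /= dH -/T HE; ring.
have Q1 : iter_num K 2 1 = T ^+ 4 * U * (4%:R + 3%:R * T).
  apply: (poly_eq_char5 (z := - 5%:R * T ^+ 5 * U)) => //.
  rewrite step [iter_num K 2 0]/= -/T deriv_exp dT; move: (T) (U) => t u; ring.
have Q2 : iter_num K 2 2 = T ^+ 4 * (1 + T - 2%:R * T ^+ 2 - T ^+ 3).
  apply: (poly_eq_char5 (z := T ^+ 4 *
    (3%:R - 30%:R * T + 48%:R * T ^+ 2 + 59%:R * T ^+ 3))) => //.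
  rewrite step Q1 !(deriv_exp, dT, dU, deriv_natr, derivM, derivD).
  transitivity (T ^+ 4 * ((1 - T) * (U ^+ 2 * (16%:R + 15%:R * T) -
    2%:R * T * (4%:R + 3%:R * T)) - 19%:R * T * U ^+ 2 * (4%:R + 3%:R * T))).
    by move: (T) (U) => t u; ring.
  by rewrite UU; move: (T) => t; ring.
apply: (poly_eq_char5 (z := T ^+ 4 * U *
  (- 2%:R * T - 8%:R * T ^+ 2 + 8%:R * T ^+ 3 + 6%:R * T ^+ 4))) => //.
rewrite step Q2 Q1 HE !(deriv_exp, dT, deriv_natr, d1, derivM, derivB, derivD).
by move: (T) (U) => t u; ring.
Qed.

(** D^3 g = D g means (n^3 - n) g_n = 0; at n = 2 and 3 the factors 6 and 24 are nonzero modulo 5.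
    The shift of [f_power_class] gives k = n + 1. *)
Lemma coef_char5 k : 5 \in [pchar K] ->
  (k%:R = 3%:R :> K) \/ (k%:R = 4%:R :> K) -> coef C k = 0.
Proof.
move=> ch; have D3 : iter 3 fpsD (f_power K 2) = iter 1 fpsD (f_power K 2).
  pose ev := fps_subst (lambda K).
  have yH : (phi K ^+ 2) ^+ 4 * ev (hasse K 2) = 1 := phi_sqr_hasse (m := 2) ch isT.
  have H0 : ev (hasse K 2) != 0.
    by apply: contra_eq_neq yH => ->; rewrite mulr0 eq_sym oner_eq0.
  apply: (mulIf (expf_neq0 3 H0)).
  rewrite (iter_fpsD (m := 2) ch isT 3) iter_num_char5 // rmorphM rmorphXn -/ev.
  transitivity ((iter 1 fpsD (f_power K 2) * ev (hasse K 2) ^+ 1) *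
    ev (hasse K 2) ^+ 2); last by ring.
  rewrite (iter_fpsD (m := 2) ch isT 1) -/ev.
  transitivity ((phi K ^+ 2) ^+ (9 * 2 + 2 * 1) * ev (iter_num K 2 1) *
    ev (hasse K 2) ^+ 2 * ((phi K ^+ 2) ^+ 4 * ev (hasse K 2))).
    by ring.
  by rewrite yH mulr1.
have vanish n : n%:R ^+ 3 - n%:R != 0 :> K -> coef (f_power K 2) n = 0.
  move=> n0; have /fpsP/(_ n)/eqP := D3.
  rewrite !coef_fpsD_iter -subr_eq0 -mulrBl expr1 mulf_eq0 (negbTE n0).
  by move=> /eqP.
have six : 6%:R != 0 :> K by rewrite -(dvdn_pcharf ch).
have t4 : 24%:R != 0 :> K by rewrite -(dvdn_pcharf ch).
have class (b : nat) : (b.+1%:R ^+ 3 - b.+1%:R != 0 :> K) -> k%:R = b.+2%:R :> K ->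
    coef C k = 0.
  move=> b0 kb; have [_ h] := @f_power_class 2 ch isT b.+1%:R.
  by apply: h => [n nb|]; [apply: vanish; rewrite nb | rewrite natr1].
case=> [/class|/class]; apply; [have -> : 2%:R ^+ 3 - 2%:R = 6%:R :> K by ring|
  have -> : 3%:R ^+ 3 - 3%:R = 24%:R :> K by ring]; done.
Qed.
End Classes.

(** * The first seven coefficients of 1/f *)

Section Small.
Variable R : comNzRingType.
Local Notation X := (@fpsX R).

Lemma phim_eqmod7 : fps_eqmod 7 (phim R) (1 - 2%:R * X + 2%:R * X ^+ 4).
Proof.
apply: fps_eqmod_trans (@theta_partP _ _ 6) _; apply/fps_eqmodP.
(* The remaining theta terms, at exponents 9, 16, 25 and 36, divided by q^7. *)
exists (- 2%:R * X ^+ 2 + 2%:R * X ^+ 9 - 2%:R * X ^+ 18 + 2%:R * X ^+ 29).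
rewrite !theta_partS /theta_part big_ord1 /= !rmorphMn !rmorphXn !rmorphN1.
by ring.
Qed.

Lemma euler4_eqmod7 : fps_eqmod 7 (fpsV (fpsV (@euler R))) (1 - X ^+ 4).
Proof.
have h := fps_eqmodV (fps_eqmodV (@eulerP R 1)).
apply: fps_eqmod_trans (fps_eqmod_le _ h) _ => //.
have e k : fpsV (1 - X ^+ k) = 1 - X ^+ (2 * k).
  by rewrite rmorphB rmorph1 rmorphXn /= fpsV_X exprM.
by rewrite /euler_prod big_ord1 !e.
Qed.

Definition f_inv_head : fps R :=
  1 + 6%:R * X + 24%:R * X ^+ 2 + 80%:R * X ^+ 3 + 240%:R * X ^+ 4
  + 660%:R * X ^+ 5 + 1696%:R * X ^+ 6.

Lemma f_inv_headP C : C * f_series R = 1 -> fps_eqmod 7 C f_inv_head.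
Proof.
move=> Cf.
(* [B] is f / q modulo q^7; each witness below is the discarded part of an exact product, divided by
   q^7. *)
pose B : fps R := 1 - 6%:R * X + 12%:R * X ^+ 2 - 8%:R * X ^+ 3
  + 12%:R * X ^+ 5 - 48%:R * X ^+ 6.
have fB : fps_eqmod 7 (f_series R) B.
  apply: fps_eqmod_trans (fps_eqmodM (fps_eqmodX 3 phim_eqmod7)
    (fps_eqmodX 6 euler4_eqmod7)) _.
  have p3 : fps_eqmod 7 ((1 - 2%:R * X + 2%:R * X ^+ 4) ^+ 3)
     (1 - 6%:R * X + 12%:R * X ^+ 2 - 8%:R * X ^+ 3 + 6%:R * X ^+ 4
      - 24%:R * X ^+ 5 + 24%:R * X ^+ 6).
    by apply/fps_eqmodP; exists (12%:R * X - 24%:R * X ^+ 2 + 8%:R * X ^+ 5); ring.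
  have e6 : fps_eqmod 7 ((1 - X ^+ 4) ^+ 6) (1 - 6%:R * X ^+ 4).
    apply/fps_eqmodP; exists (15%:R * X - 20%:R * X ^+ 5 + 15%:R * X ^+ 9
      - 6%:R * X ^+ 13 + X ^+ 17); ring.
  apply: fps_eqmod_trans (fps_eqmodM p3 e6) _; apply/fps_eqmodP.
  by exists (48%:R - 36%:R * X + 144%:R * X ^+ 2 - 144%:R * X ^+ 3); rewrite /B; ring.
have PB : fps_eqmod 7 (f_inv_head * B) 1.
  apply/fps_eqmodP; exists (- 4176%:R + 14880%:R * X - 14528%:R * X ^+ 2
    - 3600%:R * X ^+ 3 - 11328%:R * X ^+ 4 - 81408%:R * X ^+ 5).
  by rewrite /f_inv_head /B; ring.
have Pf : fps_eqmod 7 (f_inv_head * f_series R) 1.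
  by apply: fps_eqmod_trans PB; apply: fps_eqmodM.
have : fps_eqmod 7 (C * (f_inv_head * f_series R)) (C * 1) by apply: fps_eqmodM.
by rewrite mulrCA Cf !mulr1; apply: fps_eqmod_sym.
Qed.

Lemma coef_f_inv_head k : (k < 7)%N ->
  coef f_inv_head k = (nth 0%N [:: 1; 6; 24; 80; 240; 660; 1696]%N k)%:R.
Proof.
have cX (c i n : nat) : coef (c%:R * X ^+ i) n = c%:R * (n == i)%:R.
  by rewrite mulr_natl coef_fpsMn coef_fpsXn mulr_natl.
rewrite /f_inv_head -[X in 6%:R * X]expr1 !coef_fpsD !cX coef_fps1.
by case: k => [|[|[|[|[|[|[|k]]]]]]] //= _; ring.
Qed.
End Small.

(** * Change of the coefficient ring *)

Section Map.
Variables (R S : comNzRingType) (h : {rmorphism R -> S}).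

Definition fps_map (x : fps R) : fps S := Fps (fun n => h (coef x n)).

Lemma coef_fps_map x n : coef (fps_map x) n = h (coef x n). Proof. by []. Qed.

Fact fps_map_zmod : zmod_morphism fps_map.
Proof. by move=> x y; apply/fpsP => n; rewrite coef_fps_map coef_fpsB rmorphB. Qed.
Fact fps_map_monoid : monoid_morphism fps_map.
Proof.
split=> [|x y]; apply/fpsP => n; first by rewrite coef_fps_map !coef_fps1 rmorph_nat.
rewrite coef_fps_map !coef_fpsM rmorph_sum; apply: eq_bigr => i _.
by rewrite rmorphM.
Qed.
HB.instance Definition _ :=
  GRing.isZmodMorphism.Build (fps R) (fps S) fps_map fps_map_zmod.
HB.instance Definition _ :=
  GRing.isMonoidMorphism.Build (fps R) (fps S) fps_map fps_map_monoid.

Lemma fps_map_V x : fps_map (fpsV x) = fpsV (fps_map x).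
Proof.
apply/fpsP => n; rewrite coef_V !coef_fps_map coef_V.
by case: ifP => // _; rewrite rmorph0.
Qed.

Lemma fps_map_X : fps_map fpsX = fpsX.
Proof. by apply/fpsP => n; rewrite coef_fps_map /coef /= rmorph_nat. Qed.

Lemma fps_map_euler : fps_map (@euler R) = @euler S.
Proof.
apply/fpsP => n; rewrite [RHS]/coef /= -[RHS]/(coef (euler_prod fpsX n) n).
have -> : euler_prod fpsX n = fps_map (euler_prod fpsX n).
  rewrite /euler_prod rmorph_prod; apply: eq_bigr => i _.
  by rewrite rmorphB rmorph1 rmorphXn /= fps_map_X.
by [].
Qed.

Lemma fps_map_phim : fps_map (phim R) = phim S.
Proof.
apply/fpsP => n; rewrite coef_fps_map /coef /= rmorph_sum; apply: eq_bigr => j _.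
by rewrite !rmorphMn rmorphXn rmorphN1.
Qed.

Lemma fps_map_f_series : fps_map (f_series R) = f_series S.
Proof.
by rewrite /f_series rmorphM !rmorphXn /= !fps_map_V fps_map_euler fps_map_phim.
Qed.
End Map.

(** Roots of the Hasse polynomial need not lie in the prime field, so large primes are treated over
    an algebraic closure. *)
Lemma pchar_closure l : prime l ->
  {K : closedFieldType | l \in [pchar K]}.
Proof.
move=> pl; have [K [h _]] := countable_algebraic_closure 'F_l.
exists K; rewrite (fmorph_pchar h); exact: pchar_Fp.
Qed.

Lemma hasse_has_root (K : closedFieldType) m : (0 < m)%N ->
  exists a, (hasse K m).[a] = 0.
Proof.
move=> m0; have /closed_rootP[a /rootP Ha] : size (hasse K m) != 1%N.
  have hm : (m < size (hasse K m))%N.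
    rewrite ltnNge; apply/negP => /leq_sizeP/(_ m (leqnn m)) /eqP.
    by rewrite coef_hasse binn oner_eq0.
  by rewrite neq_ltn orbC (leq_ltn_trans m0).
by exists a.
Qed.

(** * From the analytic to the formal expansion *)

Local Open Scope classical_set_scope.

Section EqO.
Variable R : realType.
Implicit Types u v : R -> R.

(** Boundedness is included to make the relation stable under products; the bound 1/4 makes tails of
    ratio 2x geometric with ratio at most 1/2. *)
Definition eqO N u v := exists2 M, 0 <= M & forall x, 0 < x <= 1 / 4%:R ->
  [/\ `|u x| <= M, `|v x| <= M & `|u x - v x| <= M * x ^+ N].

Lemma eqOM N u v u' v' : eqO N u v -> eqO N u' v' ->
  eqO N (fun x => u x * u' x) (fun x => v x * v' x).
Proof.
move=> [M M0 uv] [M' M0' uv']; exists (2 * M * M') => [|x x4].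
  by rewrite !mulr_ge0.
have [ux vx dx] := uv x x4; have [ux' vx' dx'] := uv' x x4.
have MM : 0 <= M * M' by apply: mulr_ge0.
have x0 : 0 <= x ^+ N by rewrite exprn_ge0 // ltW //; case/andP: x4.
rewrite !normrM; split.
- by apply: (le_trans (ler_pM _ _ ux ux')) => //; lra.
- by apply: (le_trans (ler_pM _ _ vx vx')) => //; lra.
have -> : u x * u' x - v x * v' x = u x * (u' x - v' x) + (u x - v x) * v' x.
  by ring.
apply: le_trans (ler_normD _ _) _; rewrite !normrM.
have -> : 2 * M * M' * x ^+ N = M * (M' * x ^+ N) + M * x ^+ N * M' by ring.
by apply: lerD; apply: ler_pM.
Qed.

Lemma eqOX N u v k : eqO N u v -> eqO N (fun x => u x ^+ k) (fun x => v x ^+ k).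
Proof.
move=> uv; elim: k => [|k IH].
  by exists 1 => // x /andP[x0 _]; rewrite !expr0 normr1 subrr normr0 mul1r exprn_ge0 // ltW.
have [M M0 h] := eqOM uv IH; exists M => // x /h; by rewrite !exprS.
Qed.

Lemma poly_bound (p : {poly R}) : exists2 M, 0 <= M &
  forall x, 0 < x <= 1 / 4%:R -> `|p.[x]| <= M.
Proof.
elim/poly_ind: p => [|p c [M M0 IH]].
  by exists 0 => // x _; rewrite horner0 normr0.
exists (M + `|c|) => [|x x4]; first by rewrite addr_ge0.
rewrite hornerMXaddC; apply: le_trans (ler_normD _ _) _.
rewrite lerD2r normrM -[leRHS]mulr1 ler_pM // ?IH //.
by case/andP: x4 => x0 x4; rewrite gtr0_norm //; lra.
Qed.

(** Letting x tend to 0 kills the constant term; then x is divided out. *)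
Lemma poly_small_coef0 (p : {poly R}) N M :
  (forall x, 0 < x <= 1 / 4%:R -> `|p.[x]| <= M * x ^+ N) ->
  forall i, (i < N)%N -> p`_i = 0.
Proof.
elim: N p => // N IH p; elim/poly_ind: p => [|p c _] h i iN; first by rewrite coef0.
have [B B0 pB] := poly_bound p.
have c0 : c = 0.
  apply/eqP; rewrite -normr_le0; apply/ler_addgt0Pl => e e0; rewrite addr0.
  have M1 : 0 < `|M| + B + 1 by rewrite ltr_wpDl // addr_ge0.
  pose x := Num.min (1 / 4%:R) (e / (`|M| + B + 1)).
  have x0 : 0 < x by rewrite lt_min divr_gt0 // divr_gt0.
  have x4 : x <= 1 / 4%:R by rewrite ge_min lexx.
  have xe : x * (`|M| + B + 1) <= e by rewrite -ler_pdivlMr // ge_min lexx orbT.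
  have := h x; rewrite x0 x4 hornerMXaddC => /(_ isT) hx.
  have := pB x; rewrite x0 x4 => /(_ isT) px.
  have -> : c = p.[x] * x + c - p.[x] * x by ring.
  apply: le_trans (ler_normB _ _) _; apply: le_trans xe.
  have xN : x ^+ N.+1 <= x.
    by rewrite exprS -[leRHS]mulr1 ler_wpM2l ?exprn_ile1 //; lra.
  have e1 : M * x ^+ N.+1 <= `|M| * x.
    apply: le_trans (_ : `|M| * x ^+ N.+1 <= _); last by rewrite ler_wpM2l.
    by apply: ler_wpM2r; [rewrite exprn_ge0 // ltW|exact: ler_norm].
  have e2 : `|p.[x] * x| <= B * x by rewrite normrM (gtr0_norm x0) ler_wpM2r // ltW.
  lra.
have hp x : 0 < x <= 1 / 4%:R -> `|p.[x]| <= M * x ^+ N.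
  move=> x4; have := h x x4; rewrite hornerMXaddC c0 addr0 normrM.
  have x0 : 0 < x by case/andP: x4.
  by rewrite (gtr0_norm x0) exprSr mulrA ler_pM2r.
rewrite c0 addr0 coefMX; case: i iN => // i iN; exact: IH hp _ iN.
Qed.

Definition eulerR (x : R) N := \prod_(1 <= n < N.+1) (1 - x ^+ n).

Lemma eulerR0 x : eulerR x 0 = 1. Proof. by rewrite /eulerR big_geq. Qed.
Lemma eulerRS x N : eulerR x N.+1 = eulerR x N * (1 - x ^+ N.+1).
Proof. by rewrite /eulerR big_nat_recr. Qed.

Lemma eulerR_ge0 x N : 0 < x < 1 -> 0 <= eulerR x N.
Proof.
move=> /andP[x0 x1]; elim: N => [|N IH]; first by rewrite eulerR0.
by rewrite eulerRS mulr_ge0 // subr_ge0 exprn_ile1 // ltW.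
Qed.

Lemma eulerR_dec x : 0 < x < 1 -> nonincreasing_seq (eulerR x).
Proof.
move=> x01; apply/nonincreasing_seqP => N; rewrite eulerRS -[leRHS]mulr1.
rewrite ler_wpM2l ?eulerR_ge0 // gerBl exprn_ge0 // ltW //.
by case/andP: x01.
Qed.

Lemma eulerR_cvg x : 0 < x < 1 -> cvgn (eulerR x).
Proof.
move=> x01; apply: nonincreasing_is_cvgn; first exact: eulerR_dec.
by exists 0 => _ [N _ <-]; apply: eulerR_ge0.
Qed.

(** The summand 2 x^(M+j+1), the part of the geometric tail not yet spent, makes the induction on j
    close. *)
Lemma eulerR_lower x M j : 0 < x <= 1 / 4%:R ->
  eulerR x M * (1 - 2 * x ^+ M.+1 + 2 * x ^+ (M + j).+1) <= eulerR x (M + j).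
Proof.
move=> /andP[x0 x4]; have x01 : 0 < x < 1 by lra.
elim: j => [|j IH]; first by rewrite addn0 addrNK mulr1.
rewrite addnS eulerRS.
have u0 : 0 < x ^+ (M + j).+1 by rewrite exprn_gt0.
have u1 : x ^+ (M + j).+1 <= x ^+ M.+1.
  by rewrite ler_wiXn2l ?ltnS ?leq_addr //; lra.
have u2 : x ^+ (M + j).+2 <= x ^+ (M + j).+1 / 2.
  rewrite exprS; nra.
have v1 : x ^+ (M + j).+1 <= 1 by rewrite exprn_ile1 //; lra.
apply: le_trans (ler_wpM2r _ IH); last by rewrite subr_ge0.
rewrite -mulrA ler_wpM2l ?eulerR_ge0 //.
move: u0 u1 u2 v1; set u := x ^+ (M + j).+1; set w := x ^+ M.+1.
set t := x ^+ _.+2 => *; nra.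
Qed.

Definition eulerL x : R := limn (eulerR x).

Lemma eulerL_bounds x M : 0 < x <= 1 / 4%:R ->
  eulerR x M * (1 - 2 * x ^+ M.+1) <= eulerL x <= eulerR x M.
Proof.
move=> x4; have x01 : 0 < x < 1 by lra.
have cv := eulerR_cvg x01; apply/andP; split; last first.
  by apply: nonincreasing_cvgn_ge => //; apply: eulerR_dec.
apply: limr_ge => //; near=> N.
have MN : (M <= N)%N by near: N; exists M.
have := eulerR_lower M (N - M) x4; rewrite subnKC //; apply: le_trans.
by rewrite ler_wpM2l ?eulerR_ge0 // lerDl mulr_ge0 // exprn_ge0 // ltW //; case/andP: x4.
Unshelve. all: by end_near. Qed.

Lemma eulerR_le1 x M : 0 < x < 1 -> eulerR x M <= 1.
Proof. by move=> x01; rewrite -(eulerR0 x); apply: eulerR_dec. Qed.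

Lemma eulerL_gt0 x : 0 < x <= 1 / 4%:R -> 0 < eulerL x.
Proof.
move=> x4; have /andP[+ _] := eulerL_bounds 0 x4.
by rewrite eulerR0 expr1; lra.
Qed.

Lemma eqO_euler N k : (0 < k)%N ->
  eqO N (fun x => eulerL (x ^+ k)) (fun x => eulerR (x ^+ k) N).
Proof.
move=> k0; exists 2 => // x x4; have /andP[x0 _] := x4.
have xk : 0 < x ^+ k <= 1 / 4%:R.
  rewrite exprn_gt0 //=; apply: le_trans (_ : x ^+ 1 <= _); last by rewrite expr1; lra.
  by rewrite ler_wiXn2l //; lra.
have xk1 : 0 < x ^+ k < 1 by lra.
have := eulerL_bounds N xk; have := eulerL_gt0 xk.
have := eulerR_le1 N xk1; have := eulerR_ge0 N xk1.
have : x ^+ k ^+ N.+1 <= x ^+ N.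
  rewrite -exprM ler_wiXn2l //; [lra|lra|].
  by rewrite (leq_trans (leqnSn N)) // leq_pmull.
have : 0 < x ^+ k ^+ N.+1 by rewrite exprn_gt0 //; lra.
move: (eulerL _) (eulerR _ _) (x ^+ k ^+ _) (x ^+ N) => l r w t.
move=> w0 wt r0 r1 l0 /andP[l1 l2].
split; [by rewrite gtr0_norm //; lra|by rewrite ger0_norm //; lra|].
rewrite ler0_norm ?subr_le0 //; nra.
Qed.

(** Convergence at 1/2 gives |c_k| <= B 2^k, so for x <= 1/4 the tail after N terms is at most 2 B
    (2x)^N. *)
Lemma eqO_series (c : nat -> R) (S : R -> R) N :
  (forall x, 0 < x < 1 -> (\sum_(0 <= k < n) c k * x ^+ k) @[n --> \oo] --> S x) ->
  eqO N S (fun x => \sum_(0 <= k < N) c k * x ^+ k).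
Proof.
move=> cS.
have [B B0 cB] : exists2 B, 0 <= B & forall k, `|c k| <= B * 2 ^+ k.
  have half : 0 < 2^-1 :> R by rewrite invr_gt0 ltr0n.
  have half1 : 2^-1 < 1 :> R by rewrite invf_lt1 ?ltr1n ?ltr0n.
  have cv : cvgn (series (fun k => c k * 2^-1 ^+ k)).
    by apply: (cvgP _ (cS 2^-1 _)); rewrite half half1.
  have /cvgP /cvg_seq_bounded [B [_ hB]] := cvg_series_cvg_0 cv.
  exists (`|B| + 1) => [|k]; first by rewrite addr_ge0.
  have := hB (`|B| + 1); rewrite (le_lt_trans (ler_norm _)) ?ltrDl // => /(_ isT k I).
  rewrite /= normrM normrX (gtr0_norm half) exprVn.
  by rewrite ler_pdivrMr ?exprn_gt0 ?ltr0n.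
pose s x n := \sum_(0 <= k < n) c k * x ^+ k.
have tail x j : 0 < x <= 1 / 4%:R ->
    `|s x (N + j)%N - s x N| <= 2 * B * ((2 * x) ^+ N - (2 * x) ^+ (N + j)).
  move=> x4; have x0 : 0 < x by lra.
  elim: j => [|j IH]; first by rewrite addn0 !subrr normr0 mulr0.
  rewrite addnS /s big_nat_recr //= -/(s x _) addrAC.
  apply: le_trans (ler_normD _ _) _; rewrite normrM normrX (gtr0_norm x0).
  have e1 : `|c (N + j)%N| * x ^+ (N + j) <= B * (2 * x) ^+ (N + j).
    by rewrite exprMn mulrA ler_wpM2r // exprn_ge0 // ltW.
  have e2 : 0 <= (2 * x) ^+ (N + j) by rewrite exprn_ge0 //; lra.
  move: IH e1 e2; rewrite exprS; move: ((2 * x) ^+ (N + j)) ((2 * x) ^+ N) => u w.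
  move=> IH e1 e2; have e3 : 0 <= B * u * (1 - 4%:R * x).
    by rewrite !mulr_ge0 //; lra.
  nra.
have dist x : 0 < x <= 1 / 4%:R -> `|S x - s x N| <= 2 * B * 2 ^+ N * x ^+ N.
  move=> x4; have x0 : 0 < x by lra.
  have cv : (fun n => `|s x n - s x N|) @ \oo --> `|S x - s x N|.
    by apply: cvg_norm; apply: cvgB; [apply: cS; lra|exact: cvg_cst].
  rewrite -(cvg_lim _ cv) //; apply: limr_le; first exact: (cvgP _ cv).
  near=> n; have Nn : (N <= n)%N by near: n; exists N.
  have := tail x (n - N)%N x4; rewrite subnKC // => /le_trans; apply.
  have -> : 2 * B * 2 ^+ N * x ^+ N = 2 * B * (2 * x) ^+ N by rewrite exprMn mulrA.
  by rewrite ler_wpM2l ?mulr_ge0 // gerBl exprn_ge0 //; lra.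
have [A A0 sA] : exists2 A, 0 <= A & forall x, 0 < x <= 1 / 4%:R -> `|s x N| <= A.
  have [A A0 hA] := poly_bound (\poly_(k < N) c k); exists A => // x /hA.
  by rewrite horner_poly -(big_mkord xpredT (fun k => c k * x ^+ k)).
have BN : 0 <= 2 * B * 2 ^+ N by rewrite !mulr_ge0 // exprn_ge0.
exists (A + 2 * B * 2 ^+ N) => [|x x4]; first by rewrite addr_ge0.
have x0 : 0 <= x by lra.
have xN0 : 0 <= x ^+ N by rewrite exprn_ge0.
have xN1 : x ^+ N <= 1 by rewrite exprn_ile1 //; lra.
have h1 := dist x x4; have h2 := sA x x4.
split; [|by apply: le_trans h2 _; rewrite lerDl|].
  have -> : S x = s x N + (S x - s x N) by rewrite addrC subrK.
  apply: le_trans (ler_normD _ _) _; apply: lerD => //; apply: le_trans h1 _.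
  by rewrite -[leRHS]mulr1 ler_wpM2l.
by apply: le_trans h1 _; rewrite ler_wpM2r // lerDr.
Unshelve. all: by end_near. Qed.
End EqO.

Section OfPoly.
Variable R : comNzRingType.

Definition fps_of_poly (p : {poly R}) : fps R := Fps (fun n => p`_n).

Fact fps_of_poly_zmod : zmod_morphism fps_of_poly.
Proof. by move=> p r; apply/fpsP => n; rewrite /coef /= coefB. Qed.
Fact fps_of_poly_monoid : monoid_morphism fps_of_poly.
Proof.
split=> [|p r]; apply/fpsP => n; first by rewrite /coef /= coef1.
by rewrite coef_fpsM [LHS]/coef /= coefM.
Qed.
HB.instance Definition _ :=
  GRing.isZmodMorphism.Build {poly R} (fps R) fps_of_poly fps_of_poly_zmod.
HB.instance Definition _ :=
  GRing.isMonoidMorphism.Build {poly R} (fps R) fps_of_poly fps_of_poly_monoid.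

Lemma fps_of_polyX : fps_of_poly 'X = fpsX.
Proof. by apply/fpsP => n; rewrite /coef /= coefX. Qed.

Definition euler_poly k N : {poly R} := \prod_(1 <= n < N.+1) (1 - ('X^k) ^+ n).

Lemma fps_of_euler_poly k N :
  fps_of_poly (euler_poly k N) = euler_prod (fpsX ^+ k) N.
Proof.
rewrite /euler_poly /euler_prod rmorph_prod big_add1 /= big_mkord.
by apply: eq_bigr => i _; rewrite rmorphB rmorph1 !rmorphXn /= fps_of_polyX.
Qed.

Lemma fpsV_euler_prod k N :
  fpsV (euler_prod (@fpsX R ^+ k) N) = euler_prod (fpsX ^+ (2 * k)) N.
Proof.
rewrite /euler_prod rmorph_prod; apply: eq_bigr => i _.
by rewrite rmorphB rmorph1 !rmorphXn /= fpsV_X exprM.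
Qed.

End OfPoly.

Section Quotient.
Variable R : realType.

Lemma horner_euler_poly k N x : (euler_poly R k N).[x] = eulerR (x ^+ k) N.
Proof.
rewrite /euler_poly horner_prod; apply: eq_bigr => n _.
by rewrite hornerD hornerN hornerC horner_exp hornerXn.
Qed.

(** Modulo q^N every factor is replaced by a polynomial with error O(x^N). The difference of the two
    sides is then a polynomial of size O(x^N), so its coefficients below N vanish. *)
Lemma fps_of_real_quotient (c : nat -> int) :
  (forall x : R, 0 < x < 1 -> (\sum_(0 <= k < n) (c k)%:~R * x ^+ k) @[n --> \oo] -->
     eulerL (x ^+ 2) ^+ 3 / (eulerL x ^+ 6 * eulerL (x ^+ 4) ^+ 6)) ->
  Fps c * (@euler _ ^+ 6 * fpsV (fpsV (@euler _)) ^+ 6) = fpsV (@euler _) ^+ 3.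
Proof.
move=> cS; set lhs := Fps c * _; set rhs := _ ^+ 3.
suff e : fps_map (intr : int -> R) lhs = fps_map intr rhs.
  apply/fpsP => n; have /fpsP/(_ n) := e; rewrite !coef_fps_map => /eqP.
  by rewrite eqr_int => /eqP.
rewrite /lhs /rhs [X in X = _]rmorphM [X in _ * X = _]rmorphM !rmorphXn /=.
rewrite !fps_map_V fps_map_euler.
apply: fps_eq_eqmod => N.
have [M M0 h] := eqOM (eqO_series N cS)
  (eqOM (eqOX 6 (eqO_euler R N (isT : 0 < 1)%N)) (eqOX 6 (eqO_euler R N (isT : 0 < 4)%N))).
have [M' M0' h'] := eqOX 3 (eqO_euler R N (isT : 0 < 2)%N).
pose s : {poly R} := \poly_(k < N) (c k)%:~R.
pose p := s * (euler_poly R 1 N ^+ 6 * euler_poly R 4 N ^+ 6) - euler_poly R 2 N ^+ 3.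
have p0 : forall i, (i < N)%N -> p`_i = 0.
  apply: (@poly_small_coef0 _ _ N (M + M')) => x x4.
  have [_ _ d] := h x x4; have [_ _ d'] := h' x x4.
  move: d d'; rewrite !expr1.
  have -> : eulerL (x ^+ 2) ^+ 3 / (eulerL x ^+ 6 * eulerL (x ^+ 4) ^+ 6) *
     (eulerL x ^+ 6 * eulerL (x ^+ 4) ^+ 6) = eulerL (x ^+ 2) ^+ 3.
    rewrite divfK // mulf_neq0 // expf_neq0 // gt_eqF // eulerL_gt0 //.
    have /andP[x0 x1] := x4; rewrite exprn_gt0 //=.
    by apply: le_trans (_ : x ^+ 1 <= _); rewrite ?expr1 // -[leRHS]expr1 ler_wiXn2l //; lra.
  rewrite /p hornerD hornerN hornerM hornerM !horner_exp !horner_euler_poly expr1.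
  rewrite horner_poly.
  rewrite -(big_mkord xpredT (fun k => (c k)%:~R * x ^+ k)).
  set A := _ * (_ * _); set B := eulerR (x ^+ 2) N ^+ 3; set L := _ ^+ 3 => d d'.
  have -> : A - B = (L - B) - (L - A) by ring.
  by apply: le_trans (ler_normB _ _) _; rewrite mulrDl addrC; apply: lerD.
have e1 : fps_eqmod N (euler R) (fps_of_poly (euler_poly R 1 N)).
  by rewrite fps_of_euler_poly expr1; apply: (fps_eqmod_le _ (@eulerP R N)).
have e2 : fps_eqmod N (fpsV (euler R)) (fps_of_poly (euler_poly R 2 N)).
  rewrite fps_of_euler_poly -[2%N]/(2 * 1)%N -fpsV_euler_prod -fps_of_euler_poly.
  by apply: (fps_eqmod_le _ (fps_eqmodV e1)); lia.
have e4 : fps_eqmod N (fpsV (fpsV (euler R))) (fps_of_poly (euler_poly R 4 N)).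
  rewrite fps_of_euler_poly -[4%N]/(2 * 2)%N -fpsV_euler_prod -fps_of_euler_poly.
  by apply: (fps_eqmod_le _ (fps_eqmodV e2)); lia.
have es : fps_eqmod N (fps_map (intr : int -> R) (Fps c)) (fps_of_poly s).
  by move=> n nN; rewrite coef_fps_map /coef /= coef_poly nN.
apply: fps_eqmod_trans (fps_eqmodM es (fps_eqmodM (fps_eqmodX 6 e1) (fps_eqmodX 6 e4))) _.
apply: fps_eqmod_trans (fps_eqmod_sym (fps_eqmodX 3 e2)).
rewrite -!rmorphXn -!rmorphM; apply: fps_eqmodB0; rewrite -rmorphB => n nN.
by rewrite /coef /= p0.
Qed.

End Quotient.

(** Substitute E^6 = (phim E(q^2))^3 and cancel E(q^2)^3. *)
Lemma f_series_inv (C : fps int) :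
  C * (@euler _ ^+ 6 * fpsV (fpsV (@euler _)) ^+ 6) = fpsV (@euler _) ^+ 3 ->
  C * f_series _ = 1.
Proof.
move=> CE; have V0 : fpsV (@euler int) ^+ 3 != 0.
  rewrite expf_neq0 //; apply/eqP => /fpsP/(_ 0%N).
  by rewrite coef_V coef0_euler.
apply: (mulIf V0); rewrite mul1r -[RHS]CE -[6%N in RHS]/(2 * 3)%N exprM -phim_euler.
by rewrite /f_series; ring.
Qed.

Local Open Scope complex_scope.

(** * Values of the eta quotient on the imaginary axis *)

Section Complex.
Variable R : realType.

Lemma normc_real (x : R) : `|x%:C| = `|x|%:C :> R[i].
Proof. by rewrite normc_def /= expr0n addr0 sqrtr_sqr. Qed.

Lemma real_complex_cvg (u : nat -> R) (l : R) :
  ((u n)%:C : R[i]^o) @[n --> \oo] --> (l%:C : R[i]^o) <-> u @ \oo --> l.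
Proof.
split=> /cvgrPdist_lt h; apply/cvgrPdist_lt => e e0.
  have /h : 0 < e%:C :> R[i] by rewrite ltcR.
  by apply: filterS => n; rewrite -rmorphB normc_real ltcR.
have [e1 er] : 0 < complex.Re e /\ e = (complex.Re e)%:C.
  by case: e e0 => x y; rewrite ltcE /= => /andP[/eqP -> ->].
rewrite er; have := h _ e1.
by apply: filterS => n; rewrite -rmorphB normc_real ltcR.
Qed.

Lemma e2pii_imag (y : R) : e2pii (0 +i* y) = (expR (- (2 * pi * y)))%:C.
Proof.
rewrite /e2pii /cexp.
have -> : (0 +i* (2 * pi)) * (0 +i* y) = (- (2 * pi * y)) +i* 0 :> R[i].
  by apply/eqP; rewrite eq_complex /=; apply/andP; split; apply/eqP; ring.
by rewrite /= cos0 sin0 mulr1.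
Qed.

Lemma mul_imag (c y : R) : c%:C * (0 +i* y) = 0 +i* (c * y).
Proof. by apply/eqP; rewrite eq_complex /=; apply/andP; split; apply/eqP; ring. Qed.

Lemma eta_imag (y : R) : 0 < y ->
  eta (0 +i* y) =
    (expR (- (2 * pi * (y / 24%:R))) * eulerL (expR (- (2 * pi * y))))%:C.
Proof.
move=> y0; rewrite /eta rmorphM; congr (_ * _).
  have -> : (0 +i* y) / 24 = 0 +i* (y / 24%:R) :> R[i].
    by rewrite mulrC -(rmorph_nat (real_complex R)) -fmorphV mul_imag [y / _]mulrC.
  exact: e2pii_imag.
set x := expR _; have x01 : 0 < x < 1.
  by rewrite expR_gt0 expR_lt1 oppr_lt0 !mulr_gt0 ?pi_gt0.
have fE N : \prod_(1 <= n < N.+1) (1 - e2pii (0 +i* y) ^+ n) = (eulerR x N)%:C.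
  rewrite /eulerR rmorph_prod; apply: eq_bigr => n _.
  by rewrite e2pii_imag rmorphB rmorph1 rmorphXn.
under eq_fun => N do rewrite fE.
apply: (@cvg_lim R[i]^o); first exact: norm_hausdorff.
by apply/real_complex_cvg; apply: eulerR_cvg.
Qed.

Lemma eta_quotient_imag (y : R) : 0 < y -> let x := expR (- (2 * pi * y)) in
  eta_quotient (0 +i* y) =
    (x * (eulerL x ^+ 6 * eulerL (x ^+ 4) ^+ 6) / eulerL (x ^+ 2) ^+ 3)%:C.
Proof.
move=> y0 x; rewrite /eta_quotient.
have e4 : 4 * (0 +i* y) = 0 +i* (4%:R * y) :> R[i].
  by rewrite -(rmorph_nat (real_complex R)) mul_imag.
have e2 : 2 * (0 +i* y) = 0 +i* (2%:R * y) :> R[i].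
  by rewrite -(rmorph_nat (real_complex R)) mul_imag.
have y4 : 0 < 4%:R * y by rewrite mulr_gt0.
have y2 : 0 < 2%:R * y by rewrite mulr_gt0.
rewrite e4 e2 !eta_imag //.
set r := expR (- (2 * pi * (y / 24%:R))).
have rX k : expR (- (2 * pi * (k%:R * y / 24%:R))) = r ^+ k.
  by rewrite /r -expRM_natl; congr expR; ring.
have xX k : expR (- (2 * pi * (k%:R * y))) = x ^+ k.
  by rewrite /x -expRM_natl; congr expR; ring.
rewrite !rX !xX -/x -!rmorphXn -!rmorphM -fmorphV -rmorphM; congr (_%:C).
(* The prefactors q^(1/24) combine to r^(6 + 24 - 6) = x. *)
have xr : x = r ^+ 24.
  by rewrite -rX /x; congr (expR (- (_ * _))); field.
have r0 : r != 0 by rewrite gt_eqF // expR_gt0.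
move: (eulerL x) (eulerL (x ^+ 4)) (eulerL (x ^+ 2)) => A1 A4 A2.
rewrite xr [(r ^+ 2 * A2) ^+ 3]exprMn invfM; move: (A2 ^+ 3)^-1 => B.
by field.
Qed.

(** Take z = iy with y = - ln x / (2 pi), so that q = x is real, and multiply by x to remove the
    pole. *)
Lemma qexpansion_real (a : int -> int) :
  has_qexpansion (fun z : R[i] => (eta_quotient z)^-1) 1 a ->
  forall x : R, 0 < x < 1 ->
    (\sum_(0 <= k < n) (a (k%:Z - 1))%:~R * x ^+ k) @[n --> \oo] -->
     eulerL (x ^+ 2) ^+ 3 / (eulerL x ^+ 6 * eulerL (x ^+ 4) ^+ 6).
Proof.
move=> [_ ha] x /andP[x0 x1].
pose y := - ln x / (2 * pi).
have pi0 := pi_gt0 R.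
have y0 : 0 < y by rewrite divr_gt0 ?mulr_gt0 // oppr_gt0 ln_lt0 // x0.
have ey : expR (- (2 * pi * y)) = x.
  have p0 : 2 * pi != 0 :> R by rewrite gt_eqF // mulr_gt0.
  by rewrite /y [2 * pi * _]mulrC divfK // opprK lnK.
have := ha (0 +i* y) y0; rewrite eta_quotient_imag // ey e2pii_imag ey -fmorphV.
set T := (_ / _)^-1.
have fE N : \sum_(0 <= k < N) (a (k%:Z - 1%:Z))%:~R * x%:C ^ (k%:Z - 1%:Z)
   = ((\sum_(0 <= k < N) (a (k%:Z - 1))%:~R * x ^+ k) / x)%:C.
  rewrite mulr_suml rmorph_sum; apply: eq_bigr => k _.
  have x0' : x%:C != 0 by rewrite -(rmorph0 (real_complex R)) (inj_eq (@complexI R)) gt_eqF.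
  rewrite expfzDr // -exprnP exprN1 !rmorphM rmorph_int rmorphXn fmorphV.
  by rewrite mulrA.
under eq_fun => N do rewrite fE.
move/real_complex_cvg => h.
have -> : (fun n => \sum_(0 <= k < n) (a (k%:Z - 1))%:~R * x ^+ k) =
  (fun n => (\sum_(0 <= k < n) (a (k%:Z - 1))%:~R * x ^+ k) / x * x).
  by apply/funext => n; rewrite divfK // gt_eqF.
have -> : eulerL (x ^+ 2) ^+ 3 / (eulerL x ^+ 6 * eulerL (x ^+ 4) ^+ 6) = T * x.
  rewrite /T; move: (eulerL x ^+ 6 * _) (eulerL (x ^+ 2) ^+ 3) => P A2.
  rewrite [(x * P / A2)^-1]invfM invrK [(x * P)^-1]invfM [RHS]mulrC !mulrA.
  by rewrite divff ?mul1r 1?mulrC // gt_eqF.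
by apply: cvgM h _; apply: cvg_cst.
Qed.
End Complex.

(** * Congruence classes *)

Lemma qexpansion_fps (R : realType) (a : int -> int) :
  has_qexpansion (fun z : R[i] => (eta_quotient z)^-1) 1 a ->
  Fps (fun k => a (k%:Z - 1)) * f_series _ = 1.
Proof.
move=> ha; apply: f_series_inv; apply: (@fps_of_real_quotient R).
exact: qexpansion_real.
Qed.

Section Congruence.
Variable a : int -> int.
Hypothesis a_small : forall n : int, n < - 1 -> a n = 0.
Hypothesis aC : Fps (fun k => a (k%:Z - 1)) * f_series int = 1.

Lemma a_head k : (k < 7)%N ->
  a (k%:Z - 1) = (nth 0%N [:: 1; 6; 24; 80; 240; 660; 1696]%N k)%:Z.
Proof.
move=> k7; have := f_inv_headP aC k7; rewrite coef_f_inv_head // => e.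
by rewrite -[LHS]/(coef (Fps (fun k => a (k%:Z - 1))) k) e natz.
Qed.

Lemma a_pchar (K : fieldType) : exists2 C : fps K,
  C * f_series K = 1 & forall k, coef C k = (a (k%:Z - 1))%:~R.
Proof.
exists (fps_map intr (Fps (fun k => a (k%:Z - 1)))) => //.
by rewrite -(fps_map_f_series (intr : int -> K)) -rmorphM aC rmorph1.
Qed.

Lemma class_head l b k : (k < 7)%N ->
    (forall n : int, (l%:Z %| a (l%:Z * n + b))%Z) ->
  (b = k%:Z - 1 %[mod l])%Z ->
  (l %| nth 0%N [:: 1; 6; 24; 80; 240; 660; 1696]%N k)%N.
Proof.
move=> k7 la /eqP; rewrite eq_sym eqz_mod_dvd => /dvdzP[q eq].
by have := la q; rewrite mulrC -eq subrK (a_head k7).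
Qed.

Lemma class_vanish (l : nat) b : prime l ->
    (forall (K : fieldType) (C : fps K) k, l \in [pchar K] -> C * f_series K = 1 ->
      (k%:Z = b + 1 %[mod l])%Z -> coef C k = 0) ->
  forall n : int, (l%:Z %| a (l%:Z * n + b))%Z.
Proof.
move=> pl h n; have [ln|ln] := ltP (l%:Z * n + b) (- 1); first by rewrite a_small.
have [C Cf Ca] := a_pchar 'F_l.
have chl : l \in [pchar 'F_l] by rewrite pchar_Fp.
rewrite (dvdz_pcharf chl); have [k ek] : exists k : nat, l%:Z * n + b = k%:Z - 1.
  by exists (absz (l%:Z * n + b + 1)); lia.
rewrite ek -Ca (h _ _ _ chl Cf) //.
by apply/eqP; rewrite eqz_mod_dvd; apply/dvdzP; exists n; lia.
Qed.

Lemma natr_eq_mod (K : fieldType) (l : nat) (k j : nat) : l \in [pchar K] ->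
  (k%:Z = j%:Z %[mod l])%Z -> k%:R = j%:R :> K.
Proof.
move=> ch /eqP; rewrite eqz_mod_dvd (dvdz_pcharf ch) rmorphB subr_eq0 /=.
by rewrite -!pmulrn => /eqP.
Qed.

Lemma congruence_classes (l : nat) (hl : prime l) (b : int) :
  (forall n : int, (l%:Z %| a (l%:Z * n + b))%Z) <->
  [\/ l = 2%N /\ (b = 0 %[mod 2])%Z,
      l = 3%N /\ ((b = 0 %[mod 3])%Z \/ (b = 1 %[mod 3])%Z) |
      l = 5%N /\ ((b = 2 %[mod 5])%Z \/ (b = 3 %[mod 5])%Z)].
Proof.
split; last first.
  case=> -[el hb]; subst l; apply: class_vanish => // K C k ch Cf kb.
  - by apply: (coef_char2 Cf) => //; lia.
  - by apply: (coef_char3 Cf) => //; lia.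
  apply: (coef_char5 Cf) => //.
  by case: hb => hb; [left|right]; apply: (natr_eq_mod ch); lia.
move=> la.
have head k : (k < 7)%N ->
    ~~ (l %| nth 0 [:: 1; 6; 24; 80; 240; 660; 1696] k)%N ->
    ~ (b = k%:Z - 1 %[mod l])%Z.
  by move=> k7 /negP nk bk; apply/nk/(class_head k7 la bk).
have [l2|l2] := eqVneq l 2%N.
  constructor 1; split=> //; rewrite l2 in head.
  (* The coefficient 1 at exponent -1 excludes the class of -1. *)
  by have := head 0%N isT isT; lia.
have [l3|l3] := eqVneq l 3%N.
  constructor 2; split=> //; rewrite l3 in head.
  by have := head 0%N isT isT; lia.
have [l5|l5] := eqVneq l 5%N.
  constructor 3; split=> //; rewrite l5 in head.
  (* The coefficients 1, 6, 24 at exponents -1, 0, 1 are prime to 5. *)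
  move: (head 0%N isT isT) (head 1%N isT isT) (head 2%N isT isT); lia.
have [l7|l7] := eqVneq l 7%N.
  rewrite l7 in head; exfalso.
  (* None of the seven coefficients is divisible by 7, and their exponents meet every class. *)
  move: (head 0%N isT isT) (head 1%N isT isT) (head 2%N isT isT).
  move: (head 3%N isT isT) (head 4%N isT isT) (head 5%N isT isT).
  by move: (head 6%N isT isT); clear; lia.
have l11 : (11 <= l)%N.
  by move: l hl l2 l3 l5 l7 {la head} => [|[|[|[|[|[|[|[|[|[|[|l]]]]]]]]]]].
have [m lm] : exists m, l = (2 * m).+1.
  by exists l./2; have := even_prime hl; have := odd_double_half l; lia.
have m5 : (5 <= m)%N by lia.
have m0 : (0 < m)%N by lia.
exfalso.
have [K ch] := pchar_closure hl.
have [r Hr] := hasse_has_root K m0.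
have [C Cf Ca] := a_pchar K.
have l0 : (l%:Z != 0) by lia.
pose b0 := `|(b %% l)%Z|%N.
have eb0 : b0%:Z = (b %% l)%Z by rewrite gez0_abs // modz_ge0.
have bb : (b = b0%:Z %[mod l])%Z by rewrite eb0 modz_mod.
have b0n : b0%:R != 0 :> K.
  rewrite -(dvdn_pcharf ch); apply/negP => lb.
  (* Otherwise b lies in the class of 0, where the coefficient 6 is not divisible by l >= 11. *)
  apply: (head 1%N isT).
    by apply/negP => /(dvdn_leq (isT : 0 < 6)%N); rewrite leqNgt (leq_trans _ l11).
  by rewrite bb; apply/eqP; rewrite subrr eqz_mod_dvd subr0 /dvdz.
rewrite lm in ch; apply: (coef_pchar_large Cf ch m0 m5 Hr b0n) => n nb.
rewrite -lm in ch.
have /dvdzP[q eq] : (l%:Z %| n%:Z - 1 - b)%Z.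
  have : (n%:Z == b0%:Z + 1 %[mod l])%Z.
    rewrite eqz_mod_dvd (dvdz_pcharf ch) rmorphB rmorphD subr_eq0 /= -!pmulrn nb.
    by rewrite rmorph1.
  rewrite eqz_mod_dvd; move/eqP: bb; rewrite eqz_mod_dvd => h1 h2.
  have -> : n%:Z - 1 - b = (n%:Z - (b0%:Z + 1)) - (b - b0%:Z) by ring.
  by rewrite rpredB.
rewrite Ca; have -> : n%:Z - 1 = l%:Z * q + b by rewrite mulrC -eq subrK.
by apply/eqP; rewrite -(dvdz_pcharf ch).
Qed.
End Congruence.

Theorem theorem1p5 (R : realType) (a : int -> int)
    (ha : has_qexpansion (fun z : R[i] => (eta_quotient z)^-1) 1 a)
    (l : nat) (hl : prime l) (b : int) :
  (forall n : int, (l%:Z %| a (l%:Z * n + b))%Z) <->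
  [\/ l = 2%N /\ (b = 0 %[mod 2])%Z,
      l = 3%N /\ ((b = 0 %[mod 3])%Z \/ (b = 1 %[mod 3])%Z) |
      l = 5%N /\ ((b = 2 %[mod 5])%Z \/ (b = 3 %[mod 5])%Z)].
Proof.
by case: (ha) => a_small _; apply: congruence_classes (qexpansion_fps ha) l hl b.
Qed.
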